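(* (i) Let $\{T_t\}_{t\ge0}$ be a sub-Markovian semigroup on $B_b(\mathbb{R}^d)$ with the $C_b$-Feller property. Suppose that for every $t>0$ there exist a Radon measure $\mu_t$ on $\mathbb{R}^d$ and a Young function $\Phi_t:\mathbb{R}\to[0,\infty)$ with $\Phi_t(x)=0$ if and only if $x=0$, such that for every compact set $K\subset\mathbb{R}^d$ there is a constant $C(K,t)<\infty$ with $$\sup_{x\in K}|T_tu(x)|\le C(K,t)\,\|u\|_{\Phi_t}\quad\text{for all }u\in C_c^\infty(\mathbb{R}^d),\qquad(\ast)$$ where $\|\cdot\|_{\Phi_t}$ is the Orlicz norm of $\mathbb{L}^{\Phi_t}(\mu_t)$. Then $\{T_t\}_{t\ge0}$ has the strong Feller property. (ii) Conversely, let $\{T_t\}_{t\ge0}$ be a sub-Markovian semigroup on $B_b(\mathbb{R}^d)$ with the strong Feller property. Then for every $t>0$ there exist a probability measure $\mu_t$ on $\mathbb{R}^d$ and a Young function $\Phi_t:\mathbb{R}\to[0,\infty)$ with $\lim_{x\to\infty}\Phi_t(x)/x=\infty$ such that for every compact set $K\subset\mathbb{R}^d$ there is a constant $C(K,t)<\infty$ with $$\|\mathbf{1}_KT_tu\|_{L^\infty(\mu_t)}\le C(K,t)\,\|u\|_{\Phi_t}\quad\text{for all }u\in C_c^\infty(\mathbb{R}^d),$$ where $\|\cdot\|_{\Phi_t}$ is the Orlicz norm of $\mathbb{L}^{\Phi_t}(\mu_t)$. (iii) If, in addition to the assumption in (ii), one of the following conditions holds, then for every $t>0$ the probability measure $\mu_t$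 and the Young function $\Phi_t$ with $\lim_{x\to\infty}\Phi_t(x)/x=\infty$ in (ii) can be chosen such that $(\ast)$ holds for all compact sets $K\subset\mathbb{R}^d$ and all $u\in C_c^\infty(\mathbb{R}^d)$: (1) $\{T_t\}_{t\ge0}$ is weakly irreducible, i.e. for each $t>0$ and every non-empty open set $A\subset\mathbb{R}^d$ there exists some $x\in\mathbb{R}^d$ such that $P_t(x,A)>0$; (2) for every $f\in C_c^\infty(\mathbb{R}^d)$, $T_tf$ converges locally uniformly to $f$ as $t\to0$.
   Context: $B_b(\mathbb{R}^d)$ denotes the bounded Borel measurable functions on $\mathbb{R}^d$, $C_b(\mathbb{R}^d)$ the bounded continuous functions. A sub-Markovian semigroup on $B_b(\mathbb{R}^d)$ is the semigroup of operators $T_tf(x)=\int f(y)\,P_t(x,dy)$ ($T_0=\mathrm{id}$, $T_{s+t}=T_sT_t$) given by a transition function $P_t(x,dy)$ consisting of sub-probability kernels on $\mathbb{R}^d$. No strong continuity in $t$ is assumed. $C_b$-Feller property: $T_tf\in C_b(\mathbb{R}^d)$ for all $f\in C_b(\mathbb{R}^d)$ and all $t\ge0$. Strong Feller property: $T_tf\in C_b(\mathbb{R}^d)$ for all $f\in B_b(\mathbb{R}^d)$ and all $t>0$. A Young function is a convex, even function $\Phi:\mathbb{R}\to[0,\infty]$ with $\Phi(0)=0$ and $\lim_{x\to\infty}\Phi(x)=\infty$. For a Radon measure $\mu$ on $\mathbb{R}^d$, the Orlicz space is $\mathbb{L}^\Phi(\mu)=\{f:\mathbb{R}^d\to\mathbb{R}\text{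 measurable}:\int\Phi(\alpha f)\,d\mu<\infty\text{ for some }\alpha>0\}$, with Orlicz norm $$\|f\|_\Phi=\sup\Big\{\int|fg|\,d\mu:\int\Phi_c(g)\,d\mu\le1\Big\},\qquad \Phi_c(y)=\sup_{x\ge0}\big(x|y|-\Phi(x)\big).$$ *)

(* Defs.v *)
From HB Require Import structures.
From mathcomp Require Import all_boot all_order all_algebra.
From mathcomp Require Import all_classical all_reals all_analysis.

Set Implicit Arguments.
Unset Strict Implicit.
Unset Printing Implicit Defensive.

Import Order.TTheory GRing.Theory Num.Theory.
Import numFieldNormedType.Exports.

Local Open Scope classical_set_scope.
Local Open Scope ring_scope.

(* R^d is 'rV[R]_d with the library's (sup) norm, whose topology is the
   Euclidean one; the library puts no sigma-algebra on matrices, so we equip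
   row vectors with the Borel sigma-algebra. *)
HB.instance Definition _ (R : realType) (d : nat) :=
  @isMeasurable.Build (sigma_display (@open 'rV[R]_d)) 'rV[R]_d <<s @open 'rV[R]_d >>
    (@sigma_algebra0 _ setT _) (@sigma_algebraC 'rV[R]_d _)
    (@sigma_algebra_bigcup _ setT _).

Section functions.
Context {R : realType} {d : nat}.
Implicit Types f u : 'rV[R]_d -> R.

Definition Bb f : Prop := measurable_fun [set: 'rV[R]_d] f /\ bounded_fun f.

Definition Cb f : Prop := continuous f /\ bounded_fun f.

Definition unit_vec (i : 'I_d) : 'rV[R]_d := delta_mx 0 i.

Definition partials (s : seq 'I_d) f : 'rV[R]_d -> R :=
  foldr (fun i g => 'D_(unit_vec i) g) f s.

Definition smooth f : Prop :=
  forall s : seq 'I_d,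
    continuous (partials s f) /\
    (forall i x, derivable (partials s f) x (unit_vec i)).

Definition Cc_smooth f : Prop :=
  smooth f /\ compact (closure [set x | f x != 0]).

End functions.

Section semigroups.
Context {R : realType} {d : nat}.
Variable P : R -> R.-spker 'rV[R]_d ~> 'rV[R]_d.

(* The time index ranges over all of R for convenience; every condition below
   only constrains P t for t >= 0. *)
Definition semigroup_op (t : R) (f : 'rV[R]_d -> R) : 'rV[R]_d -> R :=
  fun x => \int[P t x]_y f y.

Definition sub_markov_semigroup : Prop :=
  (forall f, Bb f -> semigroup_op 0 f = f) /\
  (forall s t f, 0 <= s -> 0 <= t -> Bb f ->
     semigroup_op (s + t) f = semigroup_op s (semigroup_op t f)).

Definition Cb_feller : Prop :=
  forall t f, 0 <= t -> Cb f -> Cb (semigroup_op t f).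

Definition strong_feller : Prop :=
  forall t f, 0 < t -> Bb f -> Cb (semigroup_op t f).

Definition weakly_irreducible : Prop :=
  forall t, 0 < t -> forall A : set 'rV[R]_d, open A -> A !=set0 ->
    exists x, (0 < P t x A)%E.

Definition locally_uniformly_continuous_at0 : Prop :=
  forall f, Cc_smooth f ->
    {family compact, semigroup_op t f @[t --> 0^'+] --> f}.

End semigroups.

Section orlicz.
Local Open Scope ereal_scope.
Context {R : realType} {d : nat}.

Definition radon (mu : {measure set 'rV[R]_d -> \bar R}) : Prop :=
  (forall K, compact K -> mu K < +oo) /\
  (forall B, measurable B ->
     mu B = ereal_sup [set mu K | K in [set K | compact K /\ K `<=` B]]).

Definition young_function (Phi : R -> \bar R) : Prop :=
  [/\ forall x, 0 <= Phi x,
      forall (x y t : R), (0 <= t)%R -> (t <= 1)%R ->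
        Phi (t * x + (1 - t) * y)%R <= t%:E * Phi x + (1 - t)%:E * Phi y,
      forall x, Phi (- x)%R = Phi x,
      Phi 0%R = 0 &
      Phi x @[x --> +oo%R] --> +oo].

Definition young_conjugate (Phi : R -> \bar R) (y : R) : \bar R :=
  ereal_sup [set (x * `|y|)%:E - Phi x | x in [set x : R | (0 <= x)%R]].

Definition orlicz_norm (mu : {measure set 'rV[R]_d -> \bar R})
    (Phi : R -> \bar R) (f : 'rV[R]_d -> R) : \bar R :=
  ereal_sup [set (\int[mu]_x `|f x * g x|%:E) | g in
    [set g : 'rV[R]_d -> R | measurable_fun [set: 'rV[R]_d] g /\
       \int[mu]_x young_conjugate Phi (g x) <= 1]].

End orlicz.

Section bounds.
Local Open Scope ereal_scope.
Context {R : realType} {d : nat}.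
Variables (P : R -> R.-spker 'rV[R]_d ~> 'rV[R]_d) (t : R).
Variables (mu : {measure set 'rV[R]_d -> \bar R}) (Phi : R -> \bar R).

Definition sup_orlicz_bound : Prop :=
  forall K : set 'rV[R]_d, compact K -> exists C : R,
    forall u, Cc_smooth u ->
      ereal_sup [set `|semigroup_op P t u x|%:E | x in K] <=
      C%:E * orlicz_norm mu Phi u.

Definition Loo_orlicz_bound : Prop :=
  forall K : set 'rV[R]_d, compact K -> exists C : R,
    forall u, Cc_smooth u ->
      'N[mu]_+oo [(fun x => (\1_K x * semigroup_op P t u x)%:E)] <=
      C%:E * orlicz_norm mu Phi u.

End bounds.

(* Main.v *)
(** For (i), let [W] be open and bounded. Smooth functions increasing to [1_W] turn
    the hypothesis into [P_t(x, W) <= C ||1_W||_Phi] for [x] in a compact [K], and by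
    Young's inequality [||1_W||_Phi <= (Phi a / a) mu(W) + 1 / a] for every [a > 0];
    hence [P_t(x, W)] is small uniformly on [K] when [mu(W)] is small. Given a Borel
    set [A], regularity of [mu] and Urysohn's lemma yield a continuous [v] that
    differs from [1_A] only on such a [W] and far from the origin, so [T_t 1_A] is
    locally a uniform limit of the continuous functions [T_t v].

    For (ii) and (iii), let [mu] be a normalised mixture of the measures [P_t(q, .)]
    over the rational points [q]. By the strong Feller property every [P_t(x, .)] is
    absolutely continuous with respect to [mu], and Dini's theorem makes this absolute
    continuity uniform for [x] in a compact set. By a de la Vallee Poussin argument
    one superlinear function [Psi] controls [int Psi(p_x) dmu] for the densities [p_x],
    locally uniformly in [x]; its Legendre transform is [Phi]. This bounds
    [|T_t u(x)|] at every [x] in the compact set, which is the estimate of (iii), and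
    the essential supremum in (ii) is no larger. *)

From HB Require Import structures.
Require Import Defs.
From mathcomp Require Import all_boot all_order all_algebra.
From mathcomp Require Import all_classical all_reals all_analysis.
From mathcomp Require Import measurable_realfun ess_sup_inf zify ring lra.

Set Implicit Arguments.
Unset Strict Implicit.
Unset Printing Implicit Defensive.

Import Order.TTheory GRing.Theory Num.Theory.
Import numFieldNormedType.Exports.

Local Open Scope classical_set_scope.
Local Open Scope ring_scope.

(** * Smooth functions *)

Section flat_functions.
Context {R : realType}.
Implicit Types (p : {poly R}) (x y : R).

(** For [p = 1] this is the classical function [exp(-1/x)], extended by 0. The polynomial factor in
    [1/x] makes the family closed under differentiation. *)
Definition flat p x : R := if 0 < x then p.[x^-1] * expR (- x^-1) else 0.

(** With [y = 1/x], the chain rule gives [(p(y) exp(-y))' = -y^2 (p'(y) - p(y)) exp(-y)]. *)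
Definition flat_deriv p : {poly R} := 'X^2 * (p - p^`()).

(** Monomial by monomial, [y^i <= i! exp(y)] by the exponential series. *)
Lemma horner_le_expR p : exists C, forall y, 0 <= y -> `|p.[y]| <= C * expR y.
Proof.
exists (\sum_(i < size p) `|p`_i| * i`!%:R) => y y0.
rewrite horner_coef mulr_suml (le_trans (ler_norm_sum _ _ _))//.
apply: ler_sum => i _; rewrite normrM normrX (ger0_norm y0) -mulrA.
apply: ler_wpM2l => //.
case: i => -[|i] ilt /=; first by rewrite expr0 fact0 mul1r -expR0 ler_expR.
rewrite -ler_pdivrMl ?ltr0n ?fact_gt0// mulrC.
by apply: le_trans (expR_ge1Dxn i y0); rewrite lerDr.
Qed.

(** The exponential bound is applied to [p * 'X^2] at [y = 1/x]; the two extra powers of [y] become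
    the factor [x^2]. *)
Lemma flat_le_sqr p : exists C, forall x, `|flat p x| <= C * x ^+ 2.
Proof.
have [C hC] := horner_le_expR (p * 'X^2).
have C0 : 0 <= C.
  by have := hC 0 (lexx _); rewrite expR0 mulr1; apply: le_trans.
exists C => x; rewrite /flat; case: ifPn => x0; last first.
  by rewrite normr0 mulr_ge0// sqr_ge0.
have y0 : 0 < x^-1 by rewrite invr_gt0.
have := hC _ (ltW y0); rewrite hornerM hornerXn normrM expRN => h.
rewrite normrM [X in _ * X <= _]ger0_norm ?invr_ge0 ?expR_ge0//.
rewrite ler_pdivrMr ?expR_gt0// -mulrA mulrCA mulrC -ler_pdivrMr ?exprn_gt0//.
by rewrite -exprVn -[X in _ * X <= _]ger0_norm ?exprn_ge0// ltW.
Qed.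

Lemma is_derive_flat p x : is_derive x 1 (flat p) (flat (flat_deriv p) x).
Proof.
have [x0|x0|->] := ltgtP x 0.
- have -> : flat (flat_deriv p) x = 0 by rewrite /flat ltNge (ltW x0).
  apply: (@near_eq_is_derive _ _ _ (cst 0)).
  near=> y; rewrite /flat ltNge ifF//=; apply/negbTE; rewrite negbK.
  by apply: ltW; near: y; exact: lt_nbhsl.
- have -> : flat (flat_deriv p) x = (flat_deriv p).[x^-1] * expR (- x^-1).
    by rewrite /flat x0.
  apply: (@near_eq_is_derive _ _ _ (fun y => p.[y^-1] * expR (- y^-1))).
    near=> y; rewrite /flat ifT//; near: y; exact: lt_nbhsr.
  have dV : is_derive x 1 (fun y : R => y^-1) (- x ^- 2).
    have := @is_deriveV _ id x 1 1; rewrite scaler1; apply.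
    by rewrite gt_eqF.
  have dp : is_derive x 1 (fun y => p.[y^-1]) (p^`().[x^-1] * - x ^- 2).
    exact: (@is_derive1_comp _ (horner p)).
  have de : is_derive x 1 (fun y : R => expR (- y^-1)) (expR (- x^-1) * x ^- 2).
    have := @is_derive1_comp _ expR (fun y => - y^-1) x _ _ (is_derive_expR _).
    by apply; rewrite -[X in is_derive _ _ _ X]opprK; exact: is_deriveN.
  have := is_deriveM dp de; congr is_derive.
  rewrite /flat_deriv !hornerE /GRing.scale /= exprVn; ring.
- have -> : flat (flat_deriv p) 0 = 0 by rewrite /flat ltxx.
  (* At the origin the quadratic bound leaves a difference quotient of size at most [|C| |h|]. *)
  have [C hC] := flat_le_sqr p.
  suff h0 : h^-1 *: ((flat p \o shift 0) (h *: 1) - flat p 0) @[h --> 0^'] --> (0 : R).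
    by apply: DeriveDef; [apply/cvg_ex; exists 0|exact: cvg_lim].
  have Ch : `|C| * `|h| @[h --> (0 : R)^'] --> 0.
    have h0 : h @[h --> (0 : R)^'] --> (0 : R) by exact: nbhs_dnbhs.
    rewrite [X in _ --> X](_ : _ = `|C| * `|0 : R|); last by rewrite normr0 mulr0.
    by apply: cvgM; [exact: cvg_cst|exact: cvg_norm].
  have Ch' : - (`|C| * `|h|) @[h --> (0 : R)^'] --> 0.
    by rewrite -[X in _ --> X](@oppr0 R); exact: cvgN.
  apply: squeeze_cvgr Ch' Ch.
  near=> h.
  rewrite -ler_norml /= addr0 [flat p 0]/flat ltxx subr0 /GRing.scale/= mulr1.
  have h0 : h != 0 by near: h; exact: nbhs_dnbhs_neq.
  rewrite normrM normfV ler_pdivrMl ?normr_gt0//.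
  apply: le_trans (hC h) _.
  rewrite (mulrCA `|h|) -(expr2 `|h|) -normrX [`|h ^+ 2|]ger0_norm ?sqr_ge0//.
  by rewrite ler_wpM2r ?sqr_ge0 ?ler_norm.
Unshelve. all: by end_near. Qed.

Lemma flat1_gt0 x : (0 < flat 1 x) = (0 < x).
Proof.
by rewrite /flat hornerE mul1r; case: ifPn; rewrite ?expR_gt0 ?ltxx// => /negbTE.
Qed.

Lemma flat1_ge0 x : 0 <= flat 1 x.
Proof. by rewrite /flat hornerE mul1r; case: ifPn; rewrite ?expR_ge0. Qed.

Lemma flat1_le1 x : flat 1 x <= 1.
Proof.
rewrite /flat hornerE mul1r; case: ifPn => // x0.
by rewrite -expR0 ler_expR oppr_le0 invr_ge0 ltW.
Qed.

End flat_functions.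

(** * Smooth functions of several variables and bumps on cubes *)

Section smooth_functions.
Context {R : realType} {d : nat}.
Implicit Types (f g : 'rV[R]_d -> R) (x : 'rV[R]_d) (i j : 'I_d).

Definition partial i f : 'rV[R]_d -> R := 'D_(unit_vec i) f.

(** A graded form of smoothness, stable under sums and products by induction on [n]; [smooth]
    itself, being about lists of indices, is awkward for the product rule. *)
Fixpoint Cn (n : nat) f : Prop :=
  continuous f /\
  if n is m.+1 then
    (forall i x, derivable f x (unit_vec i)) /\
    (forall i, Cn m (partial i f))
  else True.

(** In [partials] the last index of the list is differentiated first, so the induction removes
    indices from the end of the list. *)
Lemma Cn_smooth f : (forall n, Cn n f) -> smooth f.
Proof.
move=> Cf s; move: f {Cf}(Cf (size s).+1).
elim/last_ind: s => [f [cf [df _]]|s i ih f]; first by split.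
rewrite size_rcons => -[_ [_ Cdf]].
by rewrite /partials foldr_rcons; exact: (ih _ (Cdf i)).
Qed.

Lemma CnS n f : Cn n.+1 f -> Cn n f.
Proof.
elim: n f => [f [cf _]//|n ih f [cf [df Cdf]]].
by split => //; split => // i; exact: ih.
Qed.

Lemma Cn_cst n (a : R) : Cn n (cst a).
Proof.
elim: n a => [a|n ih a]; split => //; try exact: cst_continuous.
split=> [i x|i]; first exact: derivable_cst.
suff -> : partial i (cst a) = cst 0 by exact: (ih 0).
by apply/funext => x; rewrite /partial derive_cst.
Qed.

Lemma CnD n f g : Cn n f -> Cn n g -> Cn n (fun x => f x + g x).
Proof.
elim: n f g => [f g [cf _] [cg _]|n ih f g [cf [df Cdf]] [cg [dg Cdg]]].
  by split=> // x; apply: continuousD; [exact: cf|exact: cg].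
split=> [x|]; first by apply: continuousD; [exact: cf|exact: cg].
split=> [i x|i]; first exact: derivableD.
suff -> : partial i (fun x => f x + g x) =
    (fun x => partial i f x + partial i g x) by exact: (ih _ _ (Cdf i) (Cdg i)).
by apply/funext => x; rewrite /partial deriveD.
Qed.

Lemma CnM n f g : Cn n f -> Cn n g -> Cn n (fun x => f x * g x).
Proof.
elim: n f g => [f g [cf _] [cg _]|n ih f g Cf Cg].
  by split=> // x; apply: continuousM; [exact: cf|exact: cg].
have [cf [df Cdf]] := Cf; have [cg [dg Cdg]] := Cg.
split=> [x|]; first by apply: continuousM; [exact: cf|exact: cg].
split=> [i x|i]; first exact: derivableM.
suff -> : partial i (fun x => f x * g x) =
    (fun x => f x * partial i g x + g x * partial i f x).
  apply: CnD; first exact: (ih _ _ (CnS Cf) (Cdg i)).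
  exact: (ih _ _ (CnS Cg) (Cdf i)).
by apply/funext => x; rewrite /partial deriveM.
Qed.

Lemma Cn_onem n f : Cn n f -> Cn n (fun x => 1 - f x).
Proof.
move=> Cf; rewrite (_ : (fun _ => _) = (fun x => cst 1 x + cst (-1) x * f x)).
  by apply: CnD; [|apply: CnM]; rewrite ?Cf//; exact: Cn_cst.
by apply/funext => x; rewrite /cst/= mulN1r.
Qed.

Lemma Cn_prod n (I : Type) (r : seq I) (P : pred I) (F : I -> 'rV[R]_d -> R) :
  (forall k, Cn n (F k)) -> Cn n (fun x => \prod_(k <- r | P k) F k x).
Proof.
move=> CF; elim: r => [|k r ih].
  by under eq_fun do rewrite big_nil; exact: Cn_cst.
under eq_fun do rewrite big_cons.
by case: (P k) => //; exact: CnM.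
Qed.

Lemma Cn_exp n m f : Cn n f -> Cn n (fun x => f x ^+ m).
Proof.
move=> Cf; elim: m => [|m ih]; first exact: Cn_cst.
by under eq_fun do rewrite exprS; exact: CnM.
Qed.

(** The difference quotient in direction [j] is that of [F] when [i = j], and is identically 0
    otherwise. *)
Lemma is_derive_coord (F : R -> R) (dF : R -> R) i j x :
  (forall y : R, is_derive y 1 F (dF y)) ->
  is_derive x (unit_vec j) (fun z : 'rV[R]_d => F (z 0 i))
    ((i == j)%:R * dF (x 0 i)).
Proof.
move=> dFP.
have [<-|ij] := eqVneq i j.
  have [D V] := dFP (x 0 i).
  have E : (fun h : R => h^-1 *: (((fun z : 'rV[R]_d => F (z 0 i)) \o shift x)
      (h *: unit_vec i) - F (x 0 i))) =
    (fun h : R => h^-1 *: ((F \o shift (x 0 i)) (h *: 1) - F (x 0 i))).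
    by apply/funext => h /=; rewrite !mxE !eqxx.
  rewrite mul1r; apply: DeriveDef; first by rewrite /derivable E.
  by rewrite -V /derive E.
have E : (fun h : R => h^-1 *: (((fun z : 'rV[R]_d => F (z 0 i)) \o shift x)
      (h *: unit_vec j) - F (x 0 i))) = cst 0.
  apply/funext => h /=; rewrite !mxE eqxx (negbTE ij)/= mulr0 add0r subrr.
  by rewrite scaler0.
rewrite mul0r; apply: DeriveDef; rewrite /derivable /derive E.
  exact: is_cvg_cst.
exact: lim_cst.
Qed.

(** The induction on [n] keeps [p] general: each partial derivative is a constant times a function
    of the same form, with [flat_deriv p] in place of [p]. *)
Lemma Cn_flat_coord n (p : {poly R}) (s c : R) i :
  Cn n (fun x => flat p (s * x 0 i + c)).
Proof.
have dF (q : {poly R}) (y : R) :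
    is_derive y 1 (fun z => flat q (s * z + c)) (flat (flat_deriv q) (s * y + c) * s).
  apply: (@is_derive1_comp _ (flat q) (fun z => s * z + c)).
    exact: is_derive_flat.
  have -> : (fun z => s * z + c) = cst s * id + cst c by [].
  have := is_deriveD (is_deriveM (is_derive_cst s y 1) (is_derive_id y 1))
    (is_derive_cst c y 1).
  by congr is_derive; rewrite /GRing.scale/= /cst/= !mulr1 mulr0 !addr0.
have cF (q : {poly R}) : continuous (fun x : 'rV[R]_d => flat q (s * x 0 i + c)).
  move=> x; apply: (@continuous_comp _ _ _ (fun x : 'rV[R]_d => x 0 i)
    (fun z => flat q (s * z + c))); first exact: coord_continuous.
  by apply/differentiable_continuous/derivable1_diffP; have [] := dF q (x 0 i).
elim: n p => [p|n ih p]; split => //.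
split=> [j x|j].
  by have [] := @is_derive_coord (fun z => flat p (s * z + c)) _ i j x (dF p).
suff -> : partial j (fun x => flat p (s * x 0 i + c)) =
    (fun x => cst ((i == j)%:R * s) x * flat (flat_deriv p) (s * x 0 i + c)).
  exact: (CnM (Cn_cst n _) (ih _)).
apply/funext => x; rewrite /partial.
have [_ ->] := @is_derive_coord (fun z => flat p (s * z + c)) _ i j x (dF p).
by rewrite /cst/= mulrA mulrAC.
Qed.

(** Balls of the sup norm are cubes. Each coordinate contributes two factors, one vanishing beyond
    each of the two opposite faces [x_i = q_i - r] and [x_i = q_i + r]. *)
Definition cube_bump (q : 'rV[R]_d) (r : R) (x : 'rV[R]_d) : R :=
  \prod_i (flat 1 (1 * x 0 i + (r - q 0 i)) * flat 1 (-1 * x 0 i + (r + q 0 i))).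

Lemma Cn_cube_bump n q r : Cn n (cube_bump q r).
Proof. by apply: Cn_prod => i; apply: CnM; exact: Cn_flat_coord. Qed.

Lemma cube_bump_ge0 q r x : 0 <= cube_bump q r x.
Proof. by apply: prodr_ge0 => i _; rewrite mulr_ge0// flat1_ge0. Qed.

Lemma cube_bump_le1 q r x : cube_bump q r x <= 1.
Proof.
apply: prodr_ile1 => i _.
by rewrite mulr_ge0 ?flat1_ge0//= mulr_ile1 ?flat1_ge0 ?flat1_le1.
Qed.

Lemma cube_bump_gt0 q r x : 0 < r -> (0 < cube_bump q r x) <-> ball q r x.
Proof.
move=> r0; have itv i : (0 < flat 1 (1 * x 0 i + (r - q 0 i)) *
    flat 1 (-1 * x 0 i + (r + q 0 i))) <-> ball (q 0 i) r (x 0 i).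
  split=> [h|].
    have : 0 < flat 1 (1 * x 0 i + (r - q 0 i)) /\
           0 < flat 1 (-1 * x 0 i + (r + q 0 i)).
      by split; rewrite lt_neqAle flat1_ge0 andbT eq_sym;
        apply: contraTneq h => ->; rewrite ?mul0r ?mulr0 ltxx.
    rewrite !flat1_gt0 /ball/= => -[h1 h2].
    by rewrite ltr_norml; lra.
  rewrite /ball/= ltr_norml => h.
  by apply: mulr_gt0; rewrite flat1_gt0; lra.
split=> [h|[_ h]].
  split => // i j; rewrite (ord1 i); apply/itv.
  rewrite lt_neqAle mulr_ge0 ?flat1_ge0// andbT eq_sym.
  by apply: contraTneq h => h; rewrite /cube_bump (bigD1 j)//= h mul0r ltxx.
by apply: prodr_gt0 => i _; apply/itv.
Qed.

End smooth_functions.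

(** * Borel sets and smooth approximation of open sets *)

Section borel_space.
Context {R : realType} {d : nat}.
Implicit Types (f g : 'rV[R]_d -> R) (x : 'rV[R]_d) (A B U W K : set 'rV[R]_d).

Lemma open_measurable_rV U : open U -> measurable U.
Proof. exact: sub_gen_smallest. Qed.

Lemma closed_measurable_rV A : closed A -> measurable A.
Proof.
move=> cA; rewrite -(setCK A); apply: measurableC.
by apply: open_measurable_rV; exact: closed_openC.
Qed.

Lemma compact_measurable_rV K : compact K -> measurable K.
Proof.
move=> cK; apply: closed_measurable_rV.
by apply: compact_closed => //; exact: norm_hausdorff.
Qed.

Lemma continuous_measurable_rV f : continuous f -> measurable_fun setT f.
Proof.
move=> cf; apply: (measurability _ (RGenOInfty.measurableE R)) => //.
move=> _ [_ [a ->] <-]; rewrite setTI; apply: open_measurable_rV.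
by move/continuousP: cf; apply; exact: interval_open.
Qed.

Lemma compact_norm_le (M : R) : compact [set x : 'rV[R]_d | `|x| <= M].
Proof.
apply: bounded_closed_compact.
  by exists M; split; [exact: num_real|move=> N /ltW MN x /= /le_trans; apply].
apply: (@closed_comp _ _ (fun x : 'rV[R]_d => `|x|) [set r | r <= M]).
  by move=> x _; exact: norm_continuous.
exact: closed_le.
Qed.

Lemma compact_norm_ub K : compact K -> exists n : nat, K `<=` [set x | `|x| <= n%:R].
Proof.
move=> /compact_bounded [M [_ hM]].
exists (Num.truncn (`|M| + 1)).+1 => x Kx /=.
apply: le_trans (hM (`|M| + 1) _ x Kx) _.
  by rewrite (le_lt_trans (ler_norm _))// ltrDl.
by apply: ltW; exact: truncnS_gt.
Qed.

Lemma BbP f : Bb f <-> measurable_fun setT f /\ exists M, forall x, `|f x| <= M.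
Proof.
split=> -[mf].
  case=> M [_ hM]; split => //; exists (`|M| + 1) => x.
  by apply: hM => //; rewrite (le_lt_trans (ler_norm _))// ltrDl.
move=> [M hM]; split => //; exists M; split; first exact: num_real.
by move=> N MN x _ /=; rewrite (le_trans (hM x))// ltW.
Qed.

Lemma CbP f : Cb f <-> continuous f /\ exists M, forall x, `|f x| <= M.
Proof.
split=> -[cf h]; split=> //.
  by have [_] := (BbP f).1 (conj (continuous_measurable_rV cf) h).
by have [_] := (BbP f).2 (conj (continuous_measurable_rV cf) h).
Qed.

Definition ratr_row (q : 'rV[rat]_d) : 'rV[R]_d := map_mx ratr q.

(** The cubes with rational centre and radius [1/(n+1)] form a countable base of the topology. *)
Lemma rational_ball x (e : R) : 0 < e -> exists (q : 'rV[rat]_d) (n : nat),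
  ball (ratr_row q) n.+1%:R^-1 x /\ ball (ratr_row q) n.+1%:R^-1 `<=` ball x e.
Proof.
move=> e0.
(* Half of [e], because [x] and another point of the small ball are compared through its centre. *)
have [n ne] : exists n : nat, n.+1%:R^-1 < e / 2.
  near \oo => n; exists n; near: n.
  by apply: (near_infty_natSinv_lt (PosNum (_ : 0 < e / 2))); rewrite divr_gt0.
have qx i : exists q : rat, `|x 0 i - ratr q| < n.+1%:R^-1.
  have /rat_in_itvoo[q] : x 0 i - n.+1%:R^-1 < x 0 i + n.+1%:R^-1 :> R.
    by rewrite ltrD2l gtrN// invr_gt0.
  rewrite in_itv/= => h; exists q; rewrite ltr_distlC; exact: h.
have [q hq] := choice qx.
exists (\row_i q i), n.
have bq : ball (ratr_row (\row_i q i)) n.+1%:R^-1 x.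
  split => [|i j]; first by rewrite invr_gt0.
  by rewrite (ord1 i) !mxE /ball/= distrC.
split=> // y hy; rewrite (splitr e).
by apply: ball_triangle (ball_sym (le_ball (ltW ne) bq)) (le_ball (ltW ne) hy).
Unshelve. all: by end_near. Qed.

(** An enumeration of the bumps on rational cubes contained in [W]. Codes of no pair, and cubes that
    leave [W], give the zero function, so the sets of positivity cover exactly [W] when [W] is
    open. *)
Definition inner_bump W (k : nat) : 'rV[R]_d -> R :=
  if (unpickle k : option ('rV[rat]_d * nat)) is Some (q, n) then
    if `[< ball (ratr_row q) n.+1%:R^-1 `<=` W >] then
      cube_bump (ratr_row q) n.+1%:R^-1
    else cst 0
  else cst 0.

Lemma Cn_inner_bump W k n : Cn n (inner_bump W k).
Proof.
rewrite /inner_bump; case: unpickle => [[q m]|]; last exact: Cn_cst.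
by case: ifPn => _; [exact: Cn_cube_bump|exact: Cn_cst].
Qed.

Lemma inner_bump_itv W k x : 0 <= inner_bump W k x <= 1.
Proof.
rewrite /inner_bump; case: unpickle => [[q m]|]; last by rewrite lexx ler01.
case: ifPn => _; last by rewrite lexx ler01.
by rewrite cube_bump_ge0 cube_bump_le1.
Qed.

Lemma inner_bump_gt0 W k x : 0 < inner_bump W k x -> W x.
Proof.
rewrite /inner_bump; case: unpickle => [[q m]|]; last by rewrite ltxx.
case: ifPn => [/asboolP qW|_]; last by rewrite ltxx.
by move=> /cube_bump_gt0 h; apply: qW; apply: h; rewrite invr_gt0.
Qed.

Lemma ex_inner_bump_gt0 W x : open W -> W x -> exists k, 0 < inner_bump W k x.
Proof.
move=> oW Wx.
have /nbhs_ballP[e /= e0 eW] : nbhs x W by exact: open_nbhs_nbhs.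
have [q [n [qx qe]]] := rational_ball x e0.
exists (pickle (q, n)); rewrite /inner_bump pickleK.
rewrite ifT; last by apply/asboolP; exact: subset_trans qe eW.
by apply/cube_bump_gt0 => //; rewrite invr_gt0.
Qed.

(* The exponent [n] drives every factor that is not identically [1] to [0]. *)
Lemma open_smooth_approx W (M : R) : open W -> W `<=` [set x | `|x| <= M] ->
  exists u : nat -> 'rV[R]_d -> R,
  [/\ forall n, Cc_smooth (u n),
      forall n x, 0 <= u n x <= \1_W x &
      forall x, u n x @[n --> \oo] --> (\1_W x : R)].
Proof.
move=> oW WM; pose b := inner_bump W.
pose u n x : R := 1 - \prod_(k < n) (1 - b k x) ^+ n.
have b01 k x : 0 <= 1 - b k x <= 1.
  by have := inner_bump_itv W k x; rewrite -/(b k x); lra.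
have bn01 k n x : 0 <= (1 - b k x) ^+ n <= 1.
  by have /andP[? ?] := b01 k x; rewrite exprn_ge0// exprn_ile1.
have u01 n x : 0 <= u n x <= 1.
  have : 0 <= \prod_(k < n) (1 - b k x) ^+ n by apply: prodr_ge0 => k _; case/andP: (bn01 k n x).
  have : \prod_(k < n) (1 - b k x) ^+ n <= 1 by exact: prodr_ile1.
  by rewrite /u; lra.
have bW k x : ~ W x -> b k x = 0.
  move=> nWx; apply/eqP; have /andP[b0 _] := inner_bump_itv W k x.
  by rewrite -[_ == _]negbK; apply/negP => bn0; apply/nWx/(@inner_bump_gt0 _ k); rewrite lt_neqAle eq_sym bn0.
have uW n x : ~ W x -> u n x = 0.
  move=> nWx; rewrite /u big1 ?subrr// => k _.
  by rewrite bW// subr0 expr1n.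
exists u; split.
- move=> n; split.
    apply: Cn_smooth => m; apply: Cn_onem; apply: Cn_prod => k.
    by apply: Cn_exp; apply: Cn_onem; exact: Cn_inner_bump.
  apply: (@subclosed_compact _ _ [set x : 'rV[R]_d | `|x| <= M]).
  + exact: closed_closure.
  + exact: compact_norm_le.
  +
  have cM : closed [set x : 'rV[R]_d | `|x| <= M].
    apply: compact_closed; [exact: norm_hausdorff|exact: compact_norm_le].
  rewrite [X in _ `<=` X](closure_id _).1//; apply: closureS => x /= /eqP ux0.
  by apply: WM; apply: contra_notP ux0; exact: uW.
- move=> n x; rewrite indicE; have [xW|xW] := boolP (x \in W); first exact: u01.
  by rewrite uW ?lexx//; apply/set_mem; rewrite inE/= => /mem_set; apply/negP.
- move=> x; rewrite indicE; have [/set_mem xW|xW] := boolP (x \in W); last first.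
    have nWx : ~ W x by move/mem_set; apply/negP.
    by rewrite (_ : (fun n => u n x) = cst 0) ?(negbTE xW); [exact: cvg_cst|apply/funext => n; exact: uW].
  have [k0 bk0] := ex_inner_bump_gt0 oW xW.
  rewrite -[X in _ --> X]subr0; apply: cvgB; first exact: cvg_cst.
  apply: (@squeeze_cvgr _ _ _ R (cst 0) (fun n => (1 - b k0 x) ^+ n)).
  + near=> n; rewrite prodr_ge0/=; last by move=> k _; case/andP: (bn01 k n x).
    have k0n : (k0 < n)%N by near: n; exact: nbhs_infty_gt.
    rewrite (bigD1 (Ordinal k0n))//= ler_piMr//; first by case/andP: (bn01 k0 n x).
    exact: prodr_ile1.
  + exact: cvg_cst.
  + apply: cvg_expr; rewrite ger0_norm; last by case/andP: (b01 k0 x).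
    by rewrite gtrBl.
Unshelve. all: by end_near. Qed.

End borel_space.

(** * Kernel operators and Orlicz norms *)

Section bounded_functions.
Context {R : realType} {d : nat}.
Implicit Types (f g : 'rV[R]_d -> R) (A : set 'rV[R]_d).

Lemma Bb_indic A : measurable A -> Bb (\1_A : 'rV[R]_d -> R).
Proof.
move=> mA; apply/BbP; split; first exact: measurable_indic.
by exists 1 => x; rewrite indicE; case: (x \in A); rewrite ?normr1 ?normr0.
Qed.

Lemma Bb_cst (a : R) : Bb (fun _ : 'rV[R]_d => a).
Proof. by apply/BbP; split; [exact: measurable_cst|exists `|a|]. Qed.

Lemma BbD f g : Bb f -> Bb g -> Bb (fun x => f x + g x).
Proof.
move=> /BbP[mf [M hM]] /BbP[mg [N hN]]; apply/BbP; split.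
  exact: measurable_funD.
by exists (M + N) => x; rewrite (le_trans (ler_normD _ _))// lerD.
Qed.

Lemma BbZ (a : R) f : Bb f -> Bb (fun x => a * f x).
Proof.
move=> /BbP[mf [M hM]]; apply/BbP; split.
  by apply: measurable_funM => //; exact: measurable_cst.
by exists (`|a| * M) => x; rewrite normrM ler_wpM2l.
Qed.

Lemma BbB f g : Bb f -> Bb g -> Bb (fun x => f x - g x).
Proof.
move=> Bf Bg; have := BbD Bf (BbZ (-1) Bg).
by congr Bb; apply/funext => x; rewrite mulN1r.
Qed.

Lemma Bb_norm f : Bb f -> Bb (fun x => `|f x|).
Proof.
move=> /BbP[mf [M hM]]; apply/BbP; split; first exact: measurableT_comp.
by exists M => x; rewrite normr_id.
Qed.

Lemma Cb_Bb f : Cb f -> Bb f.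
Proof. by move=> [/continuous_measurable_rV mf bf]; split. Qed.

Lemma Cc_smooth_Cb f : Cc_smooth f -> Cb f.
Proof.
move=> [sf cf]; have cont : continuous f by have [] := sf [::].
split=> //.
have /compact_bounded[M [_ hM]] : compact [set f x | x in closure [set x | f x != 0]].
  by apply: continuous_compact => //; exact: continuous_subspaceT.
exists (`|M| + 1); split; first exact: num_real.
move=> N MN x _ /=; have [->|fx0] := eqVneq (f x) 0.
  by rewrite normr0 ltW// (le_lt_trans _ MN)// addr_ge0.
apply: (hM N); first by rewrite (le_lt_trans (ler_norm _))// (lt_trans _ MN)// ltrDl.
by exists x => //; exact: subset_closure.
Qed.

End bounded_functions.

(** * Integration against a sub-probability kernel *)

Section semigroup_op.
Context {R : realType} {d : nat}.
Variables (P : R -> R.-spker 'rV[R]_d ~> 'rV[R]_d) (t : R).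
Implicit Types (f g : 'rV[R]_d -> R) (A : set 'rV[R]_d) (x : 'rV[R]_d).

Local Notation T := (semigroup_op P t).

Lemma kernel_lty x A : measurable A -> (P t x A < +oo)%E.
Proof.
move=> mA; apply: le_lt_trans (ltry 1).
by apply: le_trans (sprob_kernel_le1 (P t) x); apply: le_measure; rewrite ?inE.
Qed.

Lemma Bb_integrable x f : Bb f -> (P t x).-integrable setT (EFin \o f).
Proof.
by move=> [mf bf]; apply: measurable_bounded_integrable => //; exact: kernel_lty.
Qed.

Lemma semigroup_op_indic A x : measurable A -> (T \1_A x)%:E = P t x A.
Proof.
move=> mA; rewrite /semigroup_op /Rintegral integral_indic// setIT fineK//.
by rewrite ge0_fin_numE// kernel_lty.
Qed.

Lemma le_semigroup_op f g x : Bb f -> Bb g -> (forall y, f y <= g y) -> T f x <= T g x.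
Proof. by move=> Bf Bg fg; apply: le_Rintegral => //; exact: Bb_integrable. Qed.

Lemma semigroup_opD f g x : Bb f -> Bb g -> T (fun y => f y + g y) x = T f x + T g x.
Proof. by move=> Bf Bg; apply: RintegralD => //; exact: Bb_integrable. Qed.

Lemma semigroup_opB f g x : Bb f -> Bb g -> T (fun y => f y - g y) x = T f x - T g x.
Proof. by move=> Bf Bg; apply: RintegralB => //; exact: Bb_integrable. Qed.

Lemma semigroup_opZ (a : R) f x : Bb f -> T (fun y => a * f y) x = a * T f x.
Proof. by move=> Bf; apply: RintegralZl => //; exact: Bb_integrable. Qed.

Lemma semigroup_op_cst_le (a : R) x : 0 <= a -> T (fun _ => a) x <= a.
Proof.
move=> a0; rewrite /semigroup_op Rintegral_cst// ler_piMr//.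
rewrite -lee_fin fineK ?sprob_kernel_le1//.
by rewrite ge0_fin_numE// kernel_lty.
Qed.

Lemma semigroup_op_norm f x : Bb f -> `|T f x| <= T (fun y => `|f y|) x.
Proof. by move=> Bf; apply: le_normr_Rintegral => //; exact: Bb_integrable. Qed.

Lemma semigroup_op_bound f (M : R) x : Bb f -> (forall y, `|f y| <= M) -> `|T f x| <= M.
Proof.
move=> Bf fM; have M0 : 0 <= M by apply: le_trans (fM 0).
apply: le_trans (semigroup_op_norm x Bf) _.
apply: le_trans (semigroup_op_cst_le x M0).
by apply: le_semigroup_op => //; [exact: Bb_norm|exact: Bb_cst].
Qed.

Lemma semigroup_op_dist f g h x : Bb f -> Bb g -> Bb h ->
  (forall y, `|f y - g y| <= h y) -> `|T f x - T g x| <= T h x.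
Proof.
move=> Bf Bg Bh fgh; rewrite -semigroup_opB//.
have Bfg := BbB Bf Bg; apply: le_trans (semigroup_op_norm x Bfg) _.
by apply: le_semigroup_op => //; exact: Bb_norm.
Qed.

Lemma semigroup_op_cvg (f_ : nat -> 'rV[R]_d -> R) f (M : R) x :
  (forall n, measurable_fun setT (f_ n)) -> measurable_fun setT f ->
  (forall n y, `|f_ n y| <= M) -> (forall y, f_ n y @[n --> \oo] --> f y) ->
  T (f_ n) x @[n --> \oo] --> T f x.
Proof.
move=> mf_ mf fM f_f.
have [|||||intf _ cvf] := @dominated_convergence _ _ _ (P t x) setT measurableT
  (fun n => EFin \o f_ n) (EFin \o f) (cst M%:E).
- by move=> n; exact/measurable_EFinP.
- exact/measurable_EFinP.
- by apply: aeW => y _; apply: cvg_EFin; [exact: nearW|exact: f_f].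
- by apply: (@Bb_integrable x (fun _ => M)); exact: Bb_cst.
- by apply: aeW => y n _; rewrite lee_fin.
apply: fine_cvg; rewrite fineK//.
exact: integrable_fin_num.
Qed.

End semigroup_op.

(** * Young conjugates and the Orlicz norm *)

Section orlicz_facts.
Context {R : realType} {d : nat}.
Variables (mu : {measure set 'rV[R]_d -> \bar R}) (Phi : R -> R).
Local Open Scope ereal_scope.
Local Notation conj := (young_conjugate (EFin \o Phi)).
Implicit Types (u v g : 'rV[R]_d -> R) (W : set 'rV[R]_d).

Lemma young_ineq (a y : R) : (0 <= a)%R -> (a * `|y|)%:E <= (Phi a)%:E + conj y.
Proof. by move=> a0; rewrite -leeBlDl//; apply: ereal_sup_ubound; exists a. Qed.

Lemma young_conjugate_ge0 (y : R) : Phi 0%R = 0%R -> 0 <= conj y.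
Proof.
by move=> Phi0; apply: ereal_sup_ubound; exists 0%R => //=; rewrite mul0r Phi0 sube0.
Qed.

(** A supremum over uncountably many [x] is taken, so measurability goes through lower
    semicontinuity: each superlevel set is a union of open sets. *)
Lemma measurable_young_conjugate : measurable_fun setT conj.
Proof.
apply: lower_semicontinuous_measurable; apply/lower_semicontinuousP => a.
rewrite (_ : [set _ | _] = \bigcup_(x in [set x : R | (0 <= x)%R])
    ((fun y : R => x * `|y|)%R @^-1` [set z | (a + Phi x < z)%R])).
  apply: bigcup_open => x _; apply: open_comp; last exact: open_gt.
  move=> y _; apply: continuousM; first exact: cst_continuous.
  exact: norm_continuous.
apply/seteqP; split => y /=.
  move=> /ereal_sup_gt[_ [x x0 <-]] /=; rewrite -EFinB lte_fin ltrBrDr => h.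
  by exists x.
move=> [x /= x0 h]; apply: lt_le_trans (ereal_sup_ubound _); last by exists x.
by rewrite /= -EFinB lte_fin ltrBrDr.
Qed.

(** A supremum over the empty set would be [-oo]. The function [g = 0] is admissible, since the
    conjugate vanishes at 0 when [Phi >= 0] and [Phi 0 = 0]. *)
Lemma orlicz_norm_ge0 u : (forall x, (0 <= Phi x)%R) -> Phi 0%R = 0%R ->
  0 <= orlicz_norm mu (EFin \o Phi) u.
Proof.
move=> Phi_ge0 Phi0; apply: (@le_trans _ _ (\int[mu]_x `|u x * 0|%:E)).
  by apply: integral_ge0.
apply: ereal_sup_ubound; exists (cst 0%R) => //=; split; first exact: measurable_cst.
rewrite integral0_eq// => x _.
apply/eqP; rewrite eq_le young_conjugate_ge0// andbT.
by apply: ub_ereal_sup => _ [y _ <-] /=; rewrite normr0 mulr0 -EFinB lee_fin sub0r oppr_le0.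
Qed.

Lemma le_orlicz_norm u v : measurable_fun setT u -> measurable_fun setT v ->
  (forall x, (`|u x| <= `|v x|)%R) ->
  orlicz_norm mu (EFin \o Phi) u <= orlicz_norm mu (EFin \o Phi) v.
Proof.
move=> mu_ mv uv; apply: ub_ereal_sup => _ [g [mg gle] <-].
apply: le_trans (ereal_sup_ubound _); last by exists g.
apply: ge0_le_integral => //.
- by apply/measurable_EFinP; apply: measurableT_comp => //; exact: measurable_funM.
- by apply/measurable_EFinP; apply: measurableT_comp => //; exact: measurable_funM.
- by move=> x _; rewrite lee_fin !normrM ler_wpM2r.
Qed.

(* Young's inequality [a |g| <= Phi a + conj g], integrated over [W]. *)
Lemma orlicz_norm_indic (a : R) W : (0 < a)%R -> (forall x, (0 <= Phi x)%R) ->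
  Phi 0%R = 0%R -> measurable W ->
  orlicz_norm mu (EFin \o Phi) \1_W <= (Phi a / a)%:E * mu W + (a^-1)%:E.
Proof.
move=> a0 Phi_ge0 Phi0 mW; apply: ub_ereal_sup => _ [g [mg gle] <-].
have mconj : measurable_fun setT (conj \o g).
  by apply: measurableT_comp => //; exact: measurable_young_conjugate.
have ai0 : (0 <= a^-1)%R by rewrite invr_ge0 ltW.
apply: (@le_trans _ _ (\int[mu]_x ((Phi a / a)%:E * (\1_W x)%:E + (a^-1)%:E * conj (g x)))).
  apply: ge0_le_integral => //.
  - apply/measurable_EFinP; apply: measurableT_comp => //.
    by apply: measurable_funM => //; exact: measurable_indic.
  - apply: emeasurable_funD.
      by apply: measurable_funeM; apply/measurable_EFinP; exact: measurable_indic.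
    exact: measurable_funeM.
  - move=> x _; rewrite indicE; case: (x \in W); last first.
      rewrite mul0r normr0 mule0 add0e.
      by rewrite mule_ge0 ?lee_fin//; exact: young_conjugate_ge0.
    rewrite mul1r mule1 (mulrC (Phi a)) EFinM -ge0_muleDr ?lee_fin//; last first.
      exact: young_conjugate_ge0.
    by rewrite lee_pdivlMl// -EFinM; exact/young_ineq/ltW.
rewrite ge0_integralD//; first last.
- exact: measurable_funeM.
- by move=> x _; rewrite mule_ge0 ?lee_fin//; exact: young_conjugate_ge0.
- by apply: measurable_funeM; apply/measurable_EFinP; exact: measurable_indic.
- by move=> x _; rewrite -EFinM lee_fin !mulr_ge0// indicE.
rewrite ge0_integralZl//; first last.
- by rewrite lee_fin mulr_ge0.
- by apply/measurable_EFinP; exact: measurable_indic.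
rewrite integral_indic// setIT ge0_integralZl//; last first.
  by move=> x _; exact: young_conjugate_ge0.
rewrite leeD2l// -[leRHS]mule1; exact: lee_wpmul2l.
Qed.

End orlicz_facts.

(** * From the Orlicz bound to the strong Feller property *)

Section strong_feller_of_bound.
Context {R : realType} {d : nat}.
Implicit Types (f g h : 'rV[R]_d -> R) (x : 'rV[R]_d) (A K U W : set 'rV[R]_d).

(** The [e / 3] argument for locally uniform limits; the approximant may depend on [e] and is only
    required to be continuous at [x]. *)
Lemma continuous_at_approx h x :
  (forall e : R, 0 < e -> exists g, {for x, continuous g} /\
     \forall y \near x, `|h y - g y| <= e) ->
  {for x, continuous h}.
Proof.
move=> happ; apply/(@cvgrPdist_le _ _ _ (nbhs x)) => e e0.
have e3 : 0 < e / 3 by rewrite divr_gt0.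
have [g [cg hg]] := happ _ e3.
have hgx := nbhs_singleton hg.
have /(@cvgrPdist_le _ _ _ (nbhs x))/(_ _ e3) cg' := cg.
near=> y.
have h1 : `|h y - g y| <= e / 3 by near: y.
have h2 : `|g x - g y| <= e / 3 by near: y.
rewrite (_ : h x - h y = (h x - g x) + (g x - g y) + (g y - h y)); last by ring.
apply: le_trans (ler_normD _ _) _; rewrite (distrC (g y)).
by have := ler_normD (h x - g x) (g x - g y); lra.
Unshelve. all: by end_near. Qed.

Lemma urysohn_rV A B : closed A -> closed B -> A `&` B = set0 ->
  exists f, [/\ continuous f, forall x, 0 <= f x <= 1,
    forall x, A x -> f x = 0 & forall x, B x -> f x = 1].
Proof.
move=> cA cB AB.
have [f [cf f01 f0 f1]] := (@uniform_separatorP _ R A B).1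
  (@normal_uniform_separator _ (@pseudometric_normal R _) _ _ cA cB AB).
exists f; split=> // x.
- by have := f01 (f x); rewrite /= in_itv/=; apply; exists x.
- by move=> Ax; apply: f0; exists x.
- by move=> Bx; apply: f1; exists x.
Qed.

(** Finiteness of [mu A] turns approximation of [mu A] by [mu K] into smallness of the difference
    set. *)
Lemma radon_inner (mu : {measure set 'rV[R]_d -> \bar R}) A (e : R) :
  radon mu -> measurable A -> (mu A < +oo)%E -> 0 < e ->
  exists K, [/\ compact K, K `<=` A & (mu (A `\` K) <= e%:E)%E].
Proof.
move=> [_ inner] mA muA e0.
have muAfin : mu A \is a fin_num by rewrite ge0_fin_numE.
have [|_ [K [cK KA] <-]] := @ub_ereal_sup_adherent R
  [set mu K | K in [set K | compact K /\ K `<=` A]] e e0; rewrite -inner//.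
move=> hK; exists K; split => //.
have mK := compact_measurable_rV cK.
rewrite measureD// setIidr//.
have muK : (mu K <= mu A)%E by apply: le_measure; rewrite ?inE.
have muKfin : mu K \is a fin_num by rewrite ge0_fin_numE// (le_lt_trans muK).
by rewrite leeBlDr// addeC -leeBlDr// ltW.
Qed.

Section kernel.
Variables (P : R -> R.-spker 'rV[R]_d ~> 'rV[R]_d) (t : R).
Variables (mu : {measure set 'rV[R]_d -> \bar R}).
Local Notation T := (semigroup_op P t).

(** The hypothesis applies to the smooth approximants of [\1_W]; their Orlicz norms are at most that
    of [\1_W], and dominated convergence passes to the limit on the left. *)
Lemma sup_orlicz_bound_open (Phi : R -> R) K :
  (forall r, 0 <= Phi r) -> Phi 0 = 0 ->
  sup_orlicz_bound P t mu (EFin \o Phi) -> compact K ->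
  exists2 C : R, 0 < C & forall W (M : R), open W -> W `<=` [set x | `|x| <= M] ->
    forall x, K x ->
      ((T \1_W x)%:E <= C%:E * orlicz_norm mu (EFin \o Phi) \1_W)%E.
Proof.
move=> Phi_ge0 Phi0 bound cK; have [C hC] := bound K cK.
(* A strictly positive constant makes the right-hand side [+oo], and the claim trivial, when the
   norm is infinite. *)
exists (Num.max C 1); first by rewrite lt_max ltr01 orbT.
set C' := Num.max C 1 => W M oW WM x Kx.
have C'0 : 0 < C' by rewrite lt_max ltr01 orbT.
have mW := open_measurable_rV oW.
have [u [su u01 uW]] := open_smooth_approx oW WM.
have nW0 := orlicz_norm_ge0 mu (\1_W) Phi_ge0 Phi0.
have uC n : ((T (u n) x)%:E <= C'%:E * orlicz_norm mu (EFin \o Phi) \1_W)%E.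
  apply: (@le_trans _ _ (C%:E * orlicz_norm mu (EFin \o Phi) (u n))%E).
    apply: le_trans (hC _ (su n)).
    apply: (@le_trans _ _ `|T (u n) x|%:E); first by rewrite lee_fin ler_norm.
    by apply: ereal_sup_ubound; exists x.
  apply: (@le_trans _ _ (C'%:E * orlicz_norm mu (EFin \o Phi) (u n))%E).
    apply: lee_wpmul2r; first exact: orlicz_norm_ge0.
    by rewrite lee_fin le_max lexx.
  apply: lee_wpmul2l; first by rewrite lee_fin ltW.
  apply: le_orlicz_norm; [|exact: measurable_indic|].
    by have /Cc_smooth_Cb/Cb_Bb[] := su n.
  move=> y; have /andP[u0 u1] := u01 n y.
  by rewrite !ger0_norm// (le_trans u0).
have uT : T (u n) x @[n --> \oo] --> T \1_W x.
  apply: (@semigroup_op_cvg _ _ _ _ _ _ 1) => //.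
  - by move=> n; have /Cc_smooth_Cb/Cb_Bb[] := su n.
  - move=> n y; have /andP[u0 u1] := u01 n y.
    by rewrite ger0_norm// (le_trans u1).
move: nW0 uC; case: (orlicz_norm _ _ _) => [r|_ _|//].
  move=> _ uC; rewrite -EFinM lee_fin.
  by apply: (cvgr_to_le uT); apply: nearW => n; rewrite -lee_fin EFinM.
by rewrite mulry gtr0_sg// mul1e leey.
Qed.

(** Absolute continuity of [P t x] with respect to [mu], uniform in [x] on [K], tested on bounded
    open sets only. The threshold [del] depends on neither [W] nor [M]. *)
Definition unif_abs_cont_open := forall K (e : R), compact K -> 0 < e ->
  exists2 del : R, 0 < del & forall W (M : R), open W -> W `<=` [set x | `|x| <= M] ->
    (mu W <= del%:E)%E -> forall x, K x -> T \1_W x <= e.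

Lemma sup_orlicz_bound_small (Phi : R -> R) :
  (forall r, 0 <= Phi r) -> Phi 0 = 0 ->
  sup_orlicz_bound P t mu (EFin \o Phi) -> unif_abs_cont_open.
Proof.
move=> Phi_ge0 Phi0 bound K e cK e0.
have [C C0 hC] := sup_orlicz_bound_open Phi_ge0 Phi0 bound cK.
(* This [a] makes [C / a] equal to [e / 2]; the threshold below makes the term with [mu W] at most
   [e / 2]. Writing [p + 1] avoids a division by 0 when [p = 0]. *)
pose a := 2 * C / e; have a0 : 0 < a by rewrite divr_gt0// mulr_gt0.
pose p := Phi a / a; have p0 : 0 <= p by rewrite divr_ge0// ltW.
exists (e / (2 * C * (p + 1))); first by rewrite divr_gt0// !mulr_gt0// ltr_wpDl.
move=> W M oW WM muW x Kx.
have mW := open_measurable_rV oW.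
rewrite -lee_fin; apply: le_trans (hC W M oW WM x Kx) _.
apply: (@le_trans _ _ (C%:E * (p%:E * (e / (2 * C * (p + 1)))%:E + (a^-1)%:E))%E).
  apply: lee_wpmul2l; first by rewrite lee_fin ltW.
  apply: le_trans (orlicz_norm_indic mu a0 Phi_ge0 Phi0 mW) _.
  by rewrite leeD2r// lee_wpmul2l// lee_fin.
rewrite -EFinM lee_fin.
have -> : C * (p * (e / (2 * C * (p + 1))) + a^-1) = e / 2 * (p / (p + 1)) + e / 2.
  rewrite /a; field; rewrite !gt_eqF// ltr_wpDl//.
have : e / 2 * (p / (p + 1)) <= e / 2.
  by rewrite ler_piMr ?divr_ge0 ?(ltW e0)// ler_pdivrMr ?mul1r ?lerDl// ltr_wpDl.
lra.
Qed.

Lemma semigroup_op0 x : T (fun _ => 0) x = 0.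
Proof. by rewrite /semigroup_op Rintegral_cst// mul0r. Qed.

(** The mass of the single measure [P t x] far from the origin is small. A continuous cutoff is used
    instead of an indicator so that the Feller property keeps [T psi] small near [x]. *)
Lemma cutoff_small x (e : R) : 0 < e -> exists (n : nat) (psi : 'rV[R]_d -> R),
  [/\ continuous psi, forall y, 0 <= psi y <= 1,
      forall y, n%:R <= `|y| -> psi y = 1 & T psi x < e].
Proof.
move=> e0.
have /choice[psi hpsi] (n : nat) : exists psi : 'rV[R]_d -> R,
    [/\ continuous psi, forall y, 0 <= psi y <= 1,
     forall y, `|y| <= n%:R -> psi y = 0 & forall y, n.+1%:R <= `|y| -> psi y = 1].
  apply: urysohn_rV.
  - apply: compact_closed; [exact: norm_hausdorff|exact: compact_norm_le].
  - apply: (@closed_comp _ _ (fun x : 'rV[R]_d => `|x|) [set r | n.+1%:R <= r]).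
      by move=> y _; exact: norm_continuous.
    exact: closed_ge.
  - rewrite -subset0 => y [/= h1 h2]; have := le_trans h2 h1.
    by rewrite ler_nat ltnn.
have Tpsi : T (psi n) x @[n --> \oo] --> 0.
  rewrite -(semigroup_op0 x).
  apply: (@semigroup_op_cvg _ _ _ _ _ _ 1) => //.
  - by move=> n; have [/continuous_measurable_rV] := hpsi n.
  - by move=> n y; have [_ /(_ y)/andP[p0 p1] _ _] := hpsi n; rewrite ger0_norm.
  - move=> y; apply: (@cvg_trans _ ((fun _ : nat => 0 : R) @ \oo)); last exact: cvg_cst.
    apply: near_eq_cvg; near=> n; have [_ _ -> //] := hpsi n.
    apply: ltW; near: n; exact: nbhs_infty_gtr.
have [n _ hn] : \forall n \near \oo, T (psi n) x < e by exact: (cvgr_lt _ Tpsi).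
(* The function [psi n] is only known to equal 1 from norm [n + 1] on. *)
exists n.+1, (psi n); have [c p01 _ p1] := hpsi n; split => //.
exact: (hn n (leqnn n)).
Unshelve. all: by end_near. Qed.

Lemma continuous_semigroup_op_indic A :
  (forall f, Cb f -> Cb (T f)) -> radon mu -> unif_abs_cont_open ->
  measurable A -> continuous (T \1_A).
Proof.
move=> feller rmu uac mA x0; apply: continuous_at_approx => e e0.
have e2 : 0 < e / 2 by rewrite divr_gt0.
have [n [psi [cpsi psi01 psi1 Tpsi]]] := cutoff_small x0 e2.
have Cbpsi : Cb psi.
  by apply/CbP; split=> //; exists 1 => y; have /andP[p0 p1] := psi01 y; rewrite ger0_norm.
(* This compact ball contains the unit ball around [x0], hence a neighbourhood of [x0]. *)
pose K := [set x : 'rV[R]_d | `|x| <= `|x0| + 1].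
have [del del0 hdel] := uac K _ (@compact_norm_le R d _) e2.
pose V := [set x : 'rV[R]_d | `|x| < n%:R].
have oV : open V.
  apply: (@open_comp _ _ (fun x : 'rV[R]_d => `|x|) [set r | r < n%:R]).
    by move=> y _; exact: norm_continuous.
  exact: open_lt.
have mV := open_measurable_rV oV.
have muV : (mu V < +oo)%E.
  apply: le_lt_trans (rmu.1 _ (@compact_norm_le R d n%:R)).
  apply: le_measure; rewrite ?inE//.
    by apply: compact_measurable_rV; exact: compact_norm_le.
  by move=> y /ltW.
have mAV : measurable (A `&` V) by exact: measurableI.
have mVA : measurable (V `\` A) by exact: measurableD.
have sub_lty B : measurable B -> B `<=` V -> (mu B < +oo)%E.
  by move=> mB BV; apply: le_lt_trans muV; apply: le_measure; rewrite ?inE.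
have del2 : 0 < del / 2 by rewrite divr_gt0.
have [F [cF FA muF]] := radon_inner rmu mAV (sub_lty _ mAV (@subIsetr _ _ _)) del2.
have [G [cG GA muG]] := radon_inner rmu mVA (sub_lty _ mVA (@subDsetl _ _ _)) del2.
have clF : closed F by apply: compact_closed => //; exact: norm_hausdorff.
have clG : closed G by apply: compact_closed => //; exact: norm_hausdorff.
(* Inside [V], the compact sets [F] and [G] nearly exhaust [A] and its complement. A continuous [v]
   equal to 1 on [F] and 0 off [U] can therefore be wrong within [V] only on the open set [W], of
   measure at most [del]. *)
pose U := V `\` G; pose W := U `\` F.
have oU : open U by rewrite /U setDE; apply: openI => //; exact: closed_openC.
have oW : open W by rewrite /W setDE; apply: openI => //; exact: closed_openC.
have mW := open_measurable_rV oW.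
have [v [cv v01 v0 v1]] : exists v : 'rV[R]_d -> R, [/\ continuous v, forall x, 0 <= v x <= 1,
    forall x, (~` U) x -> v x = 0 & forall x, F x -> v x = 1].
  apply: urysohn_rV => //; first exact: open_closedC.
  rewrite -subset0 => y [nUy Fy]; apply: nUy.
  have [Ay Vy] := FA _ Fy; split=> // /GA[_]; exact.
have Cbv : Cb v.
  by apply/CbP; split=> //; exists 1 => y; have /andP[p0 p1] := v01 y; rewrite ger0_norm.
have muW : (mu W <= del%:E)%E.
  apply: (@le_trans _ _ (mu (((A `&` V) `\` F) `|` ((V `\` A) `\` G)))).
    apply: le_measure; rewrite ?inE//.
      by apply: measurableU; apply: measurableD => //; exact: compact_measurable_rV.
    move=> y [[Vy nGy] nFy]; have [Ay|nAy] := pselect (A y); [left|right] => //.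
  rewrite (splitr del) EFinD; apply: le_trans (measureU2 _ _ _) (leeD muF muG).
    by apply: measurableD => //; exact: compact_measurable_rV.
  by apply: measurableD => //; exact: compact_measurable_rV.
have WM : W `<=` [set x | `|x| <= n%:R] by move=> y [[/ltW]].
(* On [F] both functions are 1, and on [W] they differ by at most 1. Off [U] one has [v = 0], and a
   point of [A] off [U] lies outside [V], where [psi = 1]. *)
have key y : `|\1_A y - v y| <= \1_W y + psi y.
  have /andP[va vb] := v01 y; have /andP[pa pb] := psi01 y.
  have [Fy|nFy] := pselect (F y).
    rewrite (v1 _ Fy) indicE mem_set ?subrr ?normr0 ?addr_ge0//; by case: (FA _ Fy).
  have [Uy|nUy] := pselect (U y).
    have -> : \1_W y = 1 :> R by rewrite indicE mem_set.
    rewrite indicE.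
    by case: (y \in A); rewrite ler_norml /=; lra.
  rewrite (v0 _ nUy) subr0 ger0_norm//.
  rewrite indicE; case: (boolP (y \in A)) => [/set_mem Ay|_]; last by rewrite addr_ge0.
  have nVy : ~ V y by move=> Vy; apply: nUy; split=> // /GA[].
  by rewrite psi1 ?lerDr// leNgt; apply/negP.
exists (T v); split; first by have [cTv _] := feller v Cbv; exact: cTv.
have cTpsi : {for x0, continuous (T psi)} by have [cTp _] := feller psi Cbpsi; exact: cTp.
near=> y.
have Ky : K y.
  rewrite /K/=.
  have : ball x0 1 y by near: y; exact: nbhsx_ballx.
  rewrite -ball_normE/= => h; rewrite -(subrK x0 y) addrC.
  by apply: le_trans (ler_normD _ _) _; rewrite lerD2l distrC ltW.
have Typsi : T psi y < e / 2 by near: y; exact: (cvgr_lt _ cTpsi).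
have TW := hdel W n%:R oW WM muW y Ky.
have BW : Bb (\1_W : 'rV[R]_d -> R) by exact: Bb_indic.
apply: le_trans (semigroup_op_dist P t y (Bb_indic mA) (Cb_Bb Cbv) (BbD BW (Cb_Bb Cbpsi)) key) _.
rewrite semigroup_opD//; last exact: Cb_Bb.
by rewrite (splitr e) lerD// ltW.
Unshelve. all: by end_near. Qed.

(* Bisection: peeling off [(c / 2) 1_{f >= c / 2}] halves the range of [f]. *)
Lemma halving_approx (Q : ('rV[R]_d -> R) -> Prop) f (c : R) (n : nat) :
  Q (fun _ => 0) ->
  (forall (a : R) A g, measurable A -> Q g -> Q (fun x => g x + a * \1_A x)) ->
  measurable_fun setT f -> (forall x, 0 <= f x <= c) ->
  exists2 g, Q g & forall x, 0 <= f x - g x <= c / 2 ^+ n.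
Proof.
move=> Q0 QA; elim: n f c => [|n ih] f c mf fc.
  by exists (fun _ => 0) => // x; rewrite expr0 divr1 subr0.
pose A := f @^-1` `[c / 2, +oo[.
have mA : measurable A by rewrite -[A]setTI; exact: mf.
have [|x|g Qg hg] := ih (fun x => f x - c / 2 * \1_A x) (c / 2).
- apply: measurable_funB => //; apply: measurable_funM.
    exact: measurable_cst.
  exact: measurable_indic.
- rewrite indicE; case: (boolP (x \in A)) => [/set_mem|/negP xA].
    by rewrite /A/= in_itv/= andbT; have := fc x; lra.
  have : f x < c / 2.
    by rewrite ltNge; apply/negP => h; apply: xA; apply/mem_set; rewrite /A/= in_itv/= h.
  by have := fc x; rewrite /=; lra.
exists (fun x => g x + c / 2 * \1_A x); first exact: QA.
move=> x; have := hg x; rewrite exprS invfM mulrA opprD addrA.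
by rewrite (addrAC (f x)).
Qed.

(** Simple functions approximate [f] uniformly and [T] does not increase the sup norm, so [T f] is a
    uniform limit of continuous functions. *)
Lemma continuous_semigroup_op f :
  (forall A, measurable A -> continuous (T \1_A)) -> Bb f -> continuous (T f).
Proof.
move=> cT Bf; have [mf [M fM]] := (BbP f).1 Bf.
pose Q g := Bb g /\ continuous (T g).
have M0 : 0 <= M by apply: le_trans (fM 0).
have QA (a : R) A g : measurable A -> Q g -> Q (fun x => g x + a * \1_A x).
  move=> mA [Bg cg]; have BA := Bb_indic mA.
  split; first by apply: BbD => //; exact: BbZ.
  rewrite (_ : T _ = fun x => T g x + a * T \1_A x).
    move=> x; apply: continuousD; first exact: (cg x).
    by apply: continuousM; [exact: cst_continuous|exact: (cT A mA x)].
  apply/funext => x; rewrite semigroup_opD//; last exact: BbZ.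
  by rewrite semigroup_opZ.
have Q0 : Q (fun _ => 0).
  split; first exact: Bb_cst.
  rewrite (_ : T _ = cst 0); first exact: cst_continuous.
  by apply/funext => x; exact: semigroup_op0.
move=> x; apply: continuous_at_approx => e e0.
have [n hn] : exists n : nat, 2 * M / 2 ^+ n < e.
  have /(cvgr_lt 0) : (2 * M * (2^-1) ^+ n) @[n --> \oo] --> (0 : R).
    rewrite -(mulr0 (2 * M)); apply: cvgM; first exact: cvg_cst.
    by apply: cvg_expr; rewrite ger0_norm ?invr_ge0// invf_lt1 ?ltr1n.
  by move=> /(_ e e0)[n _ /(_ n (leqnn n))]; exists n; rewrite -exprVn.
(* The bisection needs a nonnegative function, so [f] is shifted by its bound [M]; the shift is
   removed afterwards as a multiple of [\1_setT]. *)
have mfM : measurable_fun setT (fun y => f y + M) by exact: measurable_funD.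
have fM2 y : 0 <= f y + M <= 2 * M.
  by have := fM y; rewrite ler_norml; lra.
have [g Qg hg] := halving_approx n Q0 QA mfM fM2.
have [Bg cg] := QA (- M) setT _ measurableT Qg.
exists (T (fun y => g y + - M * \1_setT y)); split; first exact: cg.
apply: (@nearW _ (nbhs x)) => y; rewrite -semigroup_opB//.
apply: semigroup_op_bound; first exact: BbB.
move=> z; rewrite indicE mem_set// mulr1.
have := hg z; rewrite ler_norml; lra.
Qed.

End kernel.

Lemma strong_feller_of_orlicz_bound (P : R -> R.-spker 'rV[R]_d ~> 'rV[R]_d) :
  Cb_feller P ->
  (forall t : R, 0 < t ->
    exists (mu : {measure set 'rV[R]_d -> \bar R}) (Phi : R -> R),
      [/\ radon mu, forall r, 0 <= Phi r, Phi 0 = 0 &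
          sup_orlicz_bound P t mu (EFin \o Phi)]) ->
  strong_feller P.
Proof.
move=> feller bound t f t0 Bf; have [mu [Phi [rmu Phi_ge0 Phi0 bmu]]] := bound t t0.
apply/CbP; split.
  apply: continuous_semigroup_op => // A mA.
  apply: (@continuous_semigroup_op_indic P t mu) => //.
    by move=> g; apply: feller; exact: ltW.
  exact: sup_orlicz_bound_small bmu.
have [_ [M fM]] := (BbP f).1 Bf.
by exists M => x; exact: semigroup_op_bound.
Qed.

End strong_feller_of_bound.

(** * Legendre transforms *)

Section legendre.
Context {R : realType}.
Variable N : R -> nat.
(** Divergence of [N] makes [y * N y] superlinear, which keeps the supremum below finite. *)
Hypothesis Ny : forall n, exists2 Y : R, 0 <= Y & forall y, Y <= y -> (n <= N y)%N.
Implicit Types r s y z : R.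

(* Legendre transform of [y |-> |y| * N |y|], which need not be convex. *)
Definition legendre r : R := sup [set y * (`|r| - (N y)%:R) | y in [set y | 0 <= y]].

Lemma legendre_has_sup r : has_sup [set y * (`|r| - (N y)%:R) | y in [set y | 0 <= y]].
Proof.
split; first by exists (0 * (`|r| - (N 0)%:R)), 0 => //=.
(* Beyond [Y] the count [N] exceeds [|r|] and the terms are nonpositive; before [Y] they are at most
   [Y |r|]. *)
have [Y Y0 hY] := Ny (Num.truncn `|r|).+1.
exists (Y * `|r|) => _ [z /= z0 <-].
have [Yz|/ltW zY] := leP Y z.
  apply: (@le_trans _ _ 0); last by rewrite mulr_ge0.
  apply: mulr_ge0_le0 => //; rewrite subr_le0.
  by apply: ltW; apply: lt_le_trans (truncnS_gt _) _; rewrite ler_nat hY.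
apply: (@le_trans _ _ (z * `|r|)); last exact: ler_wpM2r.
by apply: ler_wpM2l => //; rewrite gerBl.
Qed.

Lemma le_legendre r y : 0 <= y -> y * (`|r| - (N y)%:R) <= legendre r.
Proof.
by move=> y0; apply: ub_le_sup; [have [] := legendre_has_sup r|exists y].
Qed.

Lemma legendre_le r z : (forall y, 0 <= y -> y * (`|r| - (N y)%:R) <= z) -> legendre r <= z.
Proof.
by move=> h; apply: ge_sup; [have [] := legendre_has_sup r|move=> _ [y y0 <-]; exact: h].
Qed.

Lemma legendre_ge0 r : 0 <= legendre r.
Proof. by apply: le_trans (le_legendre r (lexx 0)); rewrite mul0r. Qed.

(** A single [y] suffices for each slope: the transform is at least [y r - y N(y)], and
    [y = |A| + 1] beats the slope [A] once [r >= y N(y)]. *)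
Lemma legendre_superlinear : legendre r / r @[r --> +oo] --> +oo.
Proof.
apply/cvgryPge => A; pose y := `|A| + 1.
have y0 : 0 <= y by rewrite addr_ge0.
near=> r.
have r0 : 0 < r by near: r; apply: nbhs_pinfty_gt; exact: num_real.
rewrite ler_pdivlMr//; apply: le_trans (le_legendre r y0).
rewrite gtr0_norm// mulrBr.
have hr : y * (N y)%:R <= r by near: r; apply: nbhs_pinfty_ge; exact: num_real.
have : A * r <= `|A| * r by rewrite ler_wpM2r ?ler_norm// ltW.
by rewrite /y in hr *; rewrite mulrDl mul1r; lra.
Unshelve. all: by end_near. Qed.

(** Convexity holds because each competitor [y (|r| - N y)] is convex in [r]; divergence follows
    from superlinearity. *)
Lemma young_function_legendre : young_function (EFin \o legendre).
Proof.
split=> [x|x y s s0 s1|x||].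
- by rewrite lee_fin legendre_ge0.
- rewrite /= -!EFinM -EFinD lee_fin; apply: legendre_le => z z0.
  have s1' : 0 <= 1 - s by rewrite subr_ge0.
  apply: (@le_trans _ _ (s * (z * (`|x| - (N z)%:R)) + (1 - s) * (z * (`|y| - (N z)%:R)))).
    have -> : s * (z * (`|x| - (N z)%:R)) + (1 - s) * (z * (`|y| - (N z)%:R)) =
      z * ((s * `|x| + (1 - s) * `|y|) - (N z)%:R) by ring.
    apply: ler_wpM2l => //; rewrite lerB//; apply: le_trans (ler_normD _ _) _.
    by rewrite !normrM (ger0_norm s0) (ger0_norm s1').
  by apply: lerD; apply: ler_wpM2l => //; exact: le_legendre.
- by rewrite /= /legendre normrN.
- rewrite /=; congr EFin; apply/eqP; rewrite eq_le legendre_ge0 andbT.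
  by apply: legendre_le => y y0; rewrite normr0 sub0r mulrN oppr_le0 mulr_ge0.
- apply/cvgeryP/cvgryPge => A; near=> r.
  have r1 : 1 <= r by near: r; apply: nbhs_pinfty_ge; exact: num_real.
  have : `|A| <= legendre r / r.
    by near: r; move/cvgryPge : legendre_superlinear; exact.
  rewrite ler_pdivlMr ?(lt_le_trans ltr01)// => h.
  have := ler_norm A; have : `|A| <= `|A| * r by rewrite ler_peMr.
  lra.
Unshelve. all: by end_near. Qed.

(** A biconjugate never exceeds the original function, convex or not. *)
Lemma young_conjugate_legendre y :
  (young_conjugate (EFin \o legendre) y <= (`|y| * (N `|y|)%:R)%:E)%E.
Proof.
apply: ub_ereal_sup => _ [s /= s0 <-]; rewrite -EFinB lee_fin.
have := le_legendre s (normr_ge0 y); rewrite (ger0_norm s0) mulrBr (mulrC s).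
lra.
Qed.

End legendre.

(** * A counting function that tends to infinity *)

Section level_count.
Context {R : realType}.
Variable m : nat -> nat.

(* The restriction [k <= y] only makes the sum finite. *)
Definition level_count (y : R) : nat := \sum_(k < (Num.truncn y).+1) ((m k)%:R <= y)%R.

Lemma level_county n : exists2 Y : R, 0 <= Y & forall y, Y <= y -> (n <= level_count y)%N.
Proof.
(* This threshold dominates each of [m 0], ..., [m (n-1)], and also [n], so that all of these
   indices fall in the range of summation. *)
exists (\sum_(k < n) m k + n)%:R => // y Yy.
have ny : (n <= (Num.truncn y).+1)%N.
  rewrite -(ler_nat R); apply: le_trans (ltW (truncnS_gt y)).
  by apply: le_trans Yy; rewrite ler_nat leq_addl.
rewrite /level_count -(big_mkord xpredT (fun k => ((m k)%:R <= y)%R : nat)).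
rewrite (big_cat_nat _ ny)//=; apply: leq_trans (leq_addr _ _).
rewrite big_mkord (eq_bigr (fun => 1%N)); first by rewrite sum1_card card_ord.
move=> k _; rewrite (_ : _ <= _ = true)//; apply: le_trans Yy.
rewrite ler_nat (leq_trans _ (leq_addr _ _))//.
by rewrite (bigD1 k)//= leq_addr.
Qed.

End level_count.

(** * Series with finitely many unit terms and a geometric tail *)

Section geometric_bounds.
Context {R : realType}.

Lemma sum_indic_geometric_le (j n : nat) :
  \sum_(k < n) ((k < j)%:R + 2^-1 ^+ k.+1) <= j%:R + 1 :> R.
Proof.
(* The sharper bound with [minn n j] and the exact geometric remainder is what the induction on [n]
   can carry. *)
suff : \sum_(k < n) ((k < j)%:R + 2^-1 ^+ k.+1) <= (minn n j)%:R + 1 - 2^-1 ^+ n :> R.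
  move=> /le_trans; apply; have : (minn n j)%:R <= j%:R :> R by rewrite ler_nat geq_minr.
  have : 0 <= 2^-1 ^+ n :> R by rewrite exprn_ge0// invr_ge0.
  lra.
elim: n => [|n ih]; first by rewrite big_ord0 min0n expr0 add0r subrr.
rewrite big_ord_recr/=.
have -> : minn n.+1 j = (minn n j + (n < j))%N.
  by case: (ltnP n j) => nj /=; lia.
rewrite natrD; have : 2^-1 ^+ n = 2 * 2^-1 ^+ n.+1 :> R by rewrite exprS mulrA divff ?mul1r.
move: ih; lra.
Qed.

Lemma nneseries_geometric_le (f : nat -> \bar R) (j : nat) :
  (forall k, 0 <= f k)%E -> (forall k, f k <= ((k < j)%:R + 2^-1 ^+ k.+1)%:E)%E ->
  (\sum_(0 <= k <oo) f k <= (j%:R + 1)%:E)%E.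
Proof.
move=> f0 fle; apply: lime_le; first by apply: is_cvg_nneseries.
apply: nearW => n; rewrite big_mkord.
apply: (@le_trans _ _ (\sum_(k < n) ((k < j)%:R + 2^-1 ^+ k.+1)%:E)%E).
  by apply: lee_sum => k _; exact: fle.
by rewrite sumEFin lee_fin sum_indic_geometric_le.
Qed.

End geometric_bounds.

(** * From the strong Feller property to the Orlicz bound *)

Section reference_measure.
Context {R : realType} {d : nat}.
Variables (P : R -> R.-spker 'rV[R]_d ~> 'rV[R]_d) (t : R).
Implicit Types (x y : 'rV[R]_d) (A K : set 'rV[R]_d).
Local Notation T := (semigroup_op P t).

Definition rational_point (n : nat) : 'rV[R]_d :=
  if (unpickle n : option 'rV[rat]_d) is Some q then ratr_row q else 0.

Lemma continuous_eq0_rational (h : 'rV[R]_d -> R) :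
  continuous h -> (forall n, h (rational_point n) = 0) -> forall x, h x = 0.
Proof.
move=> ch h0 x; apply/eqP/negP => /negP hx.
have /nbhs_ballP[e /= e0 he] : nbhs x (h @^-1` [set r | r != 0]).
  by apply: open_nbhs_nbhs; split => //; apply: open_comp => //; exact: open_neq.
have [q [n [qx qe]]] := rational_ball x e0.
have := he _ (qe _ (ballxx _ _)); rewrite invr_gt0 ltr0n => /(_ erefl) /=.
by have := h0 (pickle q); rewrite /rational_point pickleK => ->; rewrite eqxx.
Qed.

Lemma half_exp_ge0 n : 0 <= 2^-1 ^+ n.+1 :> R.
Proof. by rewrite exprn_ge0// invr_ge0. Qed.

Definition mixture_term (n : nat) : {measure set 'rV[R]_d -> \bar R} :=
  mscale (NngNum (half_exp_ge0 n)) (P t (rational_point n)).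

Definition mixture : {measure set 'rV[R]_d -> \bar R} := mseries mixture_term 0.

(** The Dirac mass is the fallback of the normalisation: the kernels are only sub-probabilities, and
    the mixture may be zero. *)
Definition reference : probability 'rV[R]_d R :=
  mnormalize mixture (dirac (0 : 'rV[R]_d)).

Lemma mixture_lty : (mixture setT < +oo)%E.
Proof.
apply: le_lt_trans (ltry (0%:R + 1)); apply: nneseries_geometric_le => // k.
rewrite /= /mscale/= add0r -[leRHS]mule1; apply: lee_wpmul2l.
  by rewrite lee_fin half_exp_ge0.
exact: sprob_kernel_le1.
Qed.

Lemma reference_null A n : measurable A -> reference A = 0%E ->
  P t (rational_point n) A = 0%E.
Proof.
move=> mA refA; suff mixA : mixture A = 0%E.
  have : (mixture_term n A <= mixture A)%E.
    apply: le_trans (nneseries_lim_ge n.+1 _) => //.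
    by rewrite big_mkord big_ord_recr/= leeDr// sume_ge0.
  rewrite mixA /= /mscale/= pmule_rle0; last by rewrite lte_fin exprn_gt0// invr_gt0.
  by move=> PA; apply/eqP; rewrite eq_le PA measure_ge0.
have mixAT : (mixture A <= mixture setT)%E by apply: le_measure; rewrite ?inE.
move: refA; rewrite /reference /= /mnormalize.
case: ifPn => [/orP[/eqP mT0|/eqP mTy] _|].
(* If the mixture is zero, every set is null for it, whatever the fallback measure says. *)
- by apply/eqP; rewrite eq_le measure_ge0 -mT0 mixAT.
- by have := mixture_lty; rewrite mTy.
rewrite negb_or => /andP[mT0 mTy] /eqP; rewrite mule_eq0 => /orP[/eqP//|].
have mTfin : mixture setT \is a fin_num by rewrite ge0_fin_numE// mixture_lty.
by rewrite eqe invr_eq0 fine_eq0// (negbTE mT0).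
Qed.

Hypothesis strong : forall f, Bb f -> Cb (T f).

(** By the strong Feller property [P t x A] is continuous in [x], and it vanishes at the rational
    points, which are dense. *)
Lemma reference_dominates x A : measurable A -> reference A = 0%E -> P t x A = 0%E.
Proof.
move=> mA refA; have [cT _] := strong (Bb_indic mA).
rewrite -(semigroup_op_indic P t x mA); congr EFin.
apply: (continuous_eq0_rational cT) => n; apply: EFin_inj.
by rewrite semigroup_op_indic// reference_null.
Qed.

(* If the bound failed along sets [S n] with summable reference measures, the
   tails [B n] of [S] would decrease to a null set; the functions [T \1_(B n)] are
   continuous and decrease to [0], hence uniformly on [K] (Dini). *)
Lemma reference_unif_abs_cont K (e : R) : compact K -> 0 < e ->
  exists2 del : R, 0 < del & forall A, measurable A -> (reference A <= del%:E)%E ->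
    forall x, K x -> (P t x A <= e%:E)%E.
Proof.
move=> cK e0; apply: contrapT => nodel.
have /choice[S hS] (n : nat) : exists A, [/\ measurable A,
    (reference A <= (2^-1 ^+ n.+1)%:E)%E & exists2 x, K x & (e%:E < P t x A)%E].
  apply: contrapT => noA; apply: nodel; exists (2^-1 ^+ n.+1).
    by rewrite exprn_gt0// invr_gt0.
  move=> A mA Asmall x Kx; rewrite leNgt; apply/negP => ePA.
  by apply: noA; exists A; split=> //; exists x.
have mS n : measurable (S n) by have [] := hS n.
pose B n := \bigcup_(j in [set j | (n <= j)%N]) S j.
have mB n : measurable (B n) by apply: bigcup_measurable.
have BS m n : (m <= n)%N -> B n `<=` B m.
  by move=> mn y [j /= nj Sjy]; exists j => //=; exact: leq_trans nj.
have mB0 : measurable (\bigcap_n B n) by apply: bigcapT_measurable.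
have refB0 : reference (\bigcap_n B n) = 0%E.
  apply: (lim_sup_set_cvg0 mS).
  apply: le_lt_trans (ltry (0%:R + 1)); apply: nneseries_geometric_le => // k.
  by rewrite add0r; have [] := hS k.
have PB x : T \1_(B n) x @[n --> \oo] --> (0 : R).
  have -> : (fun n => T \1_(B n) x) = fine \o (P t x \o B).
    by apply/funext => n /=; rewrite -semigroup_op_indic.
  apply: fine_cvg; rewrite -[X in _ --> X](reference_dominates x mB0 refB0).
  apply: nonincreasing_cvg_mu => //; first exact: kernel_lty.
  by move=> m n mn; apply/subsetPset; exact: BS.
have [N _ hN] : \forall n \near \oo, K `<=` [set x | T \1_(B n) x < e].
  move/compact_near_coveringP : cK; apply => x Kx.
  have [n0 _ hn0] : \forall n \near \oo, T \1_(B n) x < e by exact: (cvgr_lt _ (PB x)).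
  have [cT _] := strong (Bb_indic (mB n0)).
  exists ([set y | T \1_(B n0) y < e], [set n | (n0 <= n)%N]) => /=.
    split; last by exists n0.
    by apply: (cvgr_lt _ (cT x)); exact: (hn0 n0 (leqnn n0)).
  move=> [y n] [/= hy hn]; apply: le_lt_trans hy.
  apply: le_semigroup_op; [exact: Bb_indic|exact: Bb_indic|].
  move=> z; rewrite !indicE ler_nat.
  case: (boolP (z \in B n)) => // /set_mem Bz.
  by rewrite mem_set//; exact: BS Bz.
have [_ _ [x Kx]] := hS N; apply/negP; rewrite -leNgt.
have /ltW := hN N (leqnn N) x Kx; rewrite -lee_fin semigroup_op_indic//.
by apply: le_trans; apply: le_measure; rewrite ?inE// => y Sy; exists N => /=.
Qed.

(** A named copy of [P t x] to which the finite-measure structure used by the Radon-Nikodym theorem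
    is attached. *)
Definition kernel_measure x : set 'rV[R]_d -> \bar R := P t x.

HB.instance Definition _ x := Measure.copy (kernel_measure x) (P t x).

HB.instance Definition _ x := @Measure_isFinite.Build _ _ _ (kernel_measure x)
  (@kernel_finite_transition _ _ _ _ R (P t) x).

Lemma kernel_density x : exists p : 'rV[R]_d -> R,
  [/\ measurable_fun setT p, forall y, 0 <= p y &
   forall g : 'rV[R]_d -> R, measurable_fun setT g -> (forall y, 0 <= g y) ->
   (\int[P t x]_y (g y)%:E = \int[reference]_y (g y * p y)%:E)%E].
Proof.
pose nu : {finite_measure set 'rV[R]_d -> \bar R} := kernel_measure x.
have nuref : nu `<< reference.
  by apply/null_content_dominatesP => A mA /reference_dominates; exact.
pose f := Radon_Nikodym_SigmaFinite.f nu reference.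
have ff y : f y \is a fin_num by exact: Radon_Nikodym_SigmaFinite.f_fin_num.
have f0 y : (0 <= f y)%E by exact: Radon_Nikodym_SigmaFinite.f_ge0.
have mf : measurable_fun setT f.
  exact: measurable_int (Radon_Nikodym_SigmaFinite.f_integrable nuref).
exists (fine \o f); split.
- exact: measurableT_comp.
- by move=> y; exact: fine_ge0.
move=> g mg g0; rewrite -[LHS]/(\int[nu]_y (g y)%:E)%E.
rewrite -(Radon_Nikodym_SigmaFinite.change_of_variables nuref)//; last exact/measurable_EFinP.
by apply: eq_integral => y _; rewrite /= EFinM fineK.
Qed.

(** Markov's inequality: the density has integral at most 1, so [p >= m] holds on a set of reference
    measure at most [1 / m], and [m > 1 / del] suffices. The level [m] is chosen before [x] and
    [p]. *)
Lemma kernel_density_tail K (k : nat) : compact K -> exists m : nat,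
  forall x (p : 'rV[R]_d -> R), K x -> measurable_fun setT p -> (forall y, 0 <= p y) ->
  (P t x setT = \int[reference]_y (p y)%:E)%E ->
  (P t x [set y | (m%:R <= p y)%R] <= (2^-1 ^+ k.+1)%:E)%E.
Proof.
move=> cK; have e0 : 0 < 2^-1 ^+ k.+1 :> R by rewrite exprn_gt0// invr_gt0.
have [del del0 hdel] := reference_unif_abs_cont cK e0.
pose m := (Num.truncn del^-1).+1; exists m.
move=> x p Kx mp p0 Pp.
have m0 : 0 < m%:R :> R by rewrite ltr0n.
have mset : measurable [set y | m%:R <= p y].
  rewrite (_ : [set _ | _] = p @^-1` `[m%:R, +oo[).
    by rewrite -[X in measurable X]setTI; exact: mp.
  by apply/seteqP; split => y /=; rewrite in_itv/= andbT.
apply: hdel => //.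
have mEp : measurable_fun setT (EFin \o p) by exact/measurable_EFinP.
have := le_integral_abse reference measurableT mEp m0; rewrite setTI.
have -> : [set y | (m%:R%:E <= `|(EFin \o p) y|)%E] = [set y | m%:R <= p y].
  by apply/seteqP; split => y /=; rewrite lee_fin ger0_norm.
under eq_integral do rewrite /= ger0_norm//.
rewrite -Pp => /le_trans/(_ (sprob_kernel_le1 (P t) x)) h.
apply: (@le_trans _ _ (m%:R^-1)%:E).
  by rewrite -[leRHS]mule1 lee_pdivlMl.
rewrite lee_fin -[leRHS]invrK lef_pV2 ?posrE ?invr_gt0//.
exact/ltW/truncnS_gt.
Qed.

Lemma strong_feller_orlicz_bound : exists Phi : R -> R,
  [/\ young_function (EFin \o Phi), Phi r / r @[r --> +oo] --> +oo &
      sup_orlicz_bound P t reference (EFin \o Phi)].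
Proof.
(* The level [m k] controls the tail of order [k] on the ball of radius [k]. A single sequence,
   hence a single [Phi], thus serves all compact sets. *)
have /choice[m hm] (k : nat) := kernel_density_tail k (@compact_norm_le R d k%:R).
have county := @level_county R m.
exists (legendre (level_count m)); split.
- exact: young_function_legendre.
- exact: legendre_superlinear.
move=> K cK; have [j Kj] := compact_norm_ub cK.
(* This bounds the sum over [k] of the masses under [P t x] of [p >= m k]: each is at most 1 for
   [k < j], and at most [2^-(k+1)] for [k >= j], when the ball of radius [k] contains [K]. *)
pose C : R := j%:R + 1; have C0 : 0 < C by rewrite ltr_wpDl.
exists C => u /Cc_smooth_Cb/Cb_Bb Bu; apply: ub_ereal_sup => _ [x Kx <-].
have [p [mp p0 pE]] := kernel_density x.
have PT : (P t x setT = \int[reference]_y (p y)%:E)%E.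
  have := pE (fun _ => 1) (measurable_cst _) (fun _ => ler01).
  by rewrite integral_cst// mul1e => ->; apply: eq_integral => y _; rewrite mul1r.
have mset k : measurable [set y | (m k)%:R <= p y].
  rewrite (_ : [set _ | _] = p @^-1` `[(m k)%:R, +oo[).
    by rewrite -[X in measurable X]setTI; exact: mp.
  by apply/seteqP; split => y /=; rewrite in_itv/= andbT.
(* With [g = p / C], these are the layers of [g] over the levels of [p]. Their sum dominates the
   conjugate of [Phi] at [g], and their integrals sum to at most 1. *)
pose s k y : R := C^-1 * (\1_[set y | (m k)%:R <= p y] y * p y).
have s0 k y : 0 <= s k y by rewrite mulr_ge0 ?invr_ge0 ?(ltW C0)// mulr_ge0// indicE.
have ms k : measurable_fun setT (s k).
  apply: measurable_funM; first exact: measurable_cst.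
  by apply: measurable_funM => //; exact: measurable_indic.
have ints k : (\int[reference]_y (s k y)%:E = (C^-1)%:E * P t x [set y | (m k)%:R <= p y]%R)%E.
  rewrite /s; under eq_integral do rewrite EFinM.
  rewrite ge0_integralZl//; last 3 first.
  - apply/measurable_EFinP/measurable_funM => //; exact: measurable_indic.
  - by move=> y _; rewrite lee_fin mulr_ge0// indicE.
  - by rewrite lee_fin invr_ge0 ltW.
  by rewrite -pE// integral_indic// setIT.
have mg : measurable_fun setT (fun y => C^-1 * p y).
  by apply: measurable_funM => //; exact: measurable_cst.
have conj_le y : (young_conjugate (EFin \o legendre (level_count m)) (C^-1 * p y)
    <= \sum_(0 <= k <oo) (s k y)%:E)%E.
  apply: le_trans (young_conjugate_legendre county _) _.
  set z := C^-1 * p y.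
  have z0 : 0 <= z by rewrite mulr_ge0// invr_ge0 ltW.
  (* Since [C >= 1], every level reached by [z] is reached by [p y], so [z * level_count m z] is at
     most a partial sum of the layers. *)
  have zp : z <= p y by rewrite ler_piMl// invf_le1// lerDr.
  rewrite (ger0_norm z0).
  apply: le_trans (nneseries_lim_ge (Num.truncn z).+1 _); last first.
    by move=> k _ _; rewrite lee_fin.
  rewrite big_mkord sumEFin lee_fin /level_count natr_sum mulr_sumr.
  apply: ler_sum => k _; rewrite /s indicE mulrCA mulrC -/z.
  rewrite ler_wpM2r// ler_nat.
  case: (boolP ((m k)%:R <= z)) => // mz.
  by rewrite mem_set//; exact: le_trans zp.
have conj_int : (\int[reference]_y
    young_conjugate (EFin \o legendre (level_count m)) (C^-1 * p y) <= 1)%E.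
  apply: (@le_trans _ _ (\int[reference]_y (\sum_(0 <= k <oo) (s k y)%:E))%E).
    apply: ge0_le_integral => //.
    - by move=> y _; apply: young_conjugate_ge0; have [_ _ _ [->]] := young_function_legendre county.
    - by apply: measurableT_comp => //; exact: measurable_young_conjugate.
    - by apply: ge0_emeasurable_sum => // k; [move=> y _ _; rewrite lee_fin|move=> _; exact/measurable_EFinP].
  rewrite integral_nneseries//; last 2 first.
  - by move=> k; exact/measurable_EFinP.
  - by move=> k y _; rewrite lee_fin.
  under eq_eseriesr do rewrite ints.
  rewrite nneseriesZl//.
  rewrite lee_pdivrMl// mule1; apply: nneseries_geometric_le => // k.
  have [kj|jk] := ltnP k j.
    apply: le_trans (_ : 1%E <= _)%E; last by rewrite lee_fin lerDl half_exp_ge0.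
    apply: le_trans (sprob_kernel_le1 (P t) x).
    by apply: le_measure; rewrite ?inE.
  rewrite add0r; apply: hm => //.
  by apply: le_trans (Kj _ Kx) _; rewrite ler_nat.
have [mu_ _] := Bu.
apply: (@le_trans _ _ (\int[P t x]_y `|u y|%:E)%E).
  rewrite -[leRHS]fineK ?lee_fin.
    exact: semigroup_op_norm.
  exact: (integrable_fin_num measurableT (Bb_integrable P t x (Bb_norm Bu))).
rewrite pE//; last exact: measurableT_comp.
(* The density is rewritten as [C] times the admissible function [p / C]; the remaining integral is
   one of those defining the Orlicz norm of [u]. *)
apply: (@le_trans _ _ (C%:E * \int[reference]_y `|u y * (C^-1 * p y)|%:E)%E).
  rewrite -ge0_integralZl//; last 2 first.
  - apply/measurable_EFinP; apply: measurableT_comp => //; exact: measurable_funM.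
  - by rewrite lee_fin ltW.
  rewrite le_eqVlt; apply/orP; left; apply/eqP; apply: eq_integral => y _.
  rewrite -EFinM; congr EFin; rewrite !normrM (ger0_norm (p0 y)).
  rewrite (ger0_norm (_ : 0 <= C^-1)) ?invr_ge0 ?(ltW C0)//.
  by field; rewrite gt_eqF.
apply: lee_wpmul2l; first by rewrite lee_fin ltW.
by apply: ereal_sup_ubound; exists (fun y => C^-1 * p y).
Qed.

End reference_measure.

Lemma sup_Loo_orlicz_bound (R : realType) (d : nat)
    (P : R -> R.-spker 'rV[R]_d ~> 'rV[R]_d) (t : R)
    (mu : {measure set 'rV[R]_d -> \bar R}) (Phi : R -> R) :
  (forall r, 0 <= Phi r) -> Phi 0 = 0 ->
  sup_orlicz_bound P t mu (EFin \o Phi) -> Loo_orlicz_bound P t mu (EFin \o Phi).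
Proof.
move=> Phi_ge0 Phi0 bound K cK; have [C hC] := bound K cK.
(* A nonnegative constant is required at the points off [K], where the function is 0, and for a
   measure of total mass 0. *)
exists (Num.max C 0) => u su.
have n0 := orlicz_norm_ge0 mu u Phi_ge0 Phi0.
have rhs0 : (0 <= (Num.max C 0)%:E * orlicz_norm mu (EFin \o Phi) u)%E.
  by rewrite mule_ge0// lee_fin le_max lexx orbT.
rewrite unlock; case: ifPn => // _; apply/ess_supP; apply: aeW => x /=.
rewrite indicE; case: (boolP (x \in K)) => [/set_mem Kx|_]; last by rewrite mul0r normr0.
rewrite mul1r; apply: (@le_trans _ _ (C%:E * orlicz_norm mu (EFin \o Phi) u)%E).
  by apply: le_trans (hC u su); apply: ereal_sup_ubound; exists x.
by apply: lee_wpmul2r => //; rewrite lee_fin le_max lexx.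
Qed.

Theorem theorem2p8 (R : realType) (d : nat) :
  [/\
    (* (i) *)
    forall P : R -> R.-spker 'rV[R]_d ~> 'rV[R]_d,
      sub_markov_semigroup P -> Cb_feller P ->
      (forall t : R, 0 < t ->
        exists (mu : {measure set 'rV[R]_d -> \bar R}) (Phi : R -> R),
          [/\ radon mu,
              young_function (EFin \o Phi),
              forall x, Phi x = 0 <-> x = 0 &
              sup_orlicz_bound P t mu (EFin \o Phi)]) ->
      strong_feller P,
    (* (ii) *)
    forall P : R -> R.-spker 'rV[R]_d ~> 'rV[R]_d,
      sub_markov_semigroup P -> strong_feller P ->
      forall t : R, 0 < t ->
        exists (mu : probability 'rV[R]_d R) (Phi : R -> R),
          [/\ young_function (EFin \o Phi),
              Phi x / x @[x --> +oo] --> +oo &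
              Loo_orlicz_bound P t mu (EFin \o Phi)]
  & (* (iii) *)
    forall P : R -> R.-spker 'rV[R]_d ~> 'rV[R]_d,
      sub_markov_semigroup P -> strong_feller P ->
      weakly_irreducible P \/ locally_uniformly_continuous_at0 P ->
      forall t : R, 0 < t ->
        exists (mu : probability 'rV[R]_d R) (Phi : R -> R),
          [/\ young_function (EFin \o Phi),
              Phi x / x @[x --> +oo] --> +oo,
              Loo_orlicz_bound P t mu (EFin \o Phi) &
              sup_orlicz_bound P t mu (EFin \o Phi)]].
Proof.
have converse (P : R -> R.-spker 'rV[R]_d ~> 'rV[R]_d) (t : R) :
    strong_feller P -> 0 < t ->
    exists (mu : probability 'rV[R]_d R) (Phi : R -> R),
      [/\ young_function (EFin \o Phi), Phi x / x @[x --> +oo] --> +oo,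
          Loo_orlicz_bound P t mu (EFin \o Phi) &
          sup_orlicz_bound P t mu (EFin \o Phi)].
  move=> strong t0.
  have [Phi [yPhi sPhi bPhi]] :=
    strong_feller_orlicz_bound (fun f Bf => strong t f t0 Bf).
  exists (reference P t), Phi; split => //.
  have [Phi_ge0 _ _ [Phi0] _] := yPhi.
  by apply: sup_Loo_orlicz_bound => // r; rewrite -lee_fin; exact: Phi_ge0.
split.
- move=> P _ feller bound; apply: strong_feller_of_orlicz_bound => // t t0.
  have [mu [Phi [rmu [Phi_ge0 _ _ _ _] Phi0 bmu]]] := bound t t0.
  by exists mu, Phi; split => //; exact/Phi0.
- move=> P _ strong t t0; have [mu [Phi [? ? ? _]]] := converse P t strong t0.
  by exists mu, Phi.
- by move=> P _ strong _ t t0; exact: converse.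
Qed.
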